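(* Let $d\ge1$, let $M$ be a $d\times d$ positive definite matrix with eigenvalues $\lambda_1\ge\lambda_2\ge\cdots\ge\lambda_d$, let $\Lambda$ be the $d\times d$ diagonal matrix whose $i$-th diagonal entry is $\lambda_i$, and let $Q$ be an orthogonal $d\times d$ matrix such that $M=Q\Lambda Q^{T}$. Let $\kappa>0$ and let $g:\mathbb{R}^{d}\to\mathbb{R}$ be a Borel-measurable $(\kappa,M)$-Lipschitz function with $E(g(X)^2)<\infty$ for $X\sim N(0,M)$, and such that $g(z)$ can be calculated in $O(d)$ time for $z\in\mathbb{R}^d$. Set $A=Q\sqrt{\Lambda}$ and $q_i=\sqrt{\lambda_{i+1}/\lambda_1}$ for $0\le i\le d-1$. Let $f_n$ be the output, and $T$ the expected running time, of the algorithm GRDR (described in the context) run with parameters $g,M,A,q$. Then $T\le 2cd^{2}$ for some constant $c$, and $$\mathrm{Var}(f_n)\le\frac{2\kappa^{2}}{d}\left(\sum_{i=1}^{d}\sqrt{\lambda_i}\right)^{2}.$$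
   Context: For $d\times d$ matrices $B,B'$, write $B\preccurlyeq B'$ if $B'-B$ is positive semi-definite. For $\kappa>0$, a function $g:\mathbb{R}^{d}\to\mathbb{R}$ is called $(\kappa,M)$-Lipschitz if, for any $(2d)$-dimensional centered Gaussian vector $(Y,Y')$ (with $Y,Y'$ taking values in $\mathbb{R}^d$, possibly degenerate) such that $\mathrm{Cov}(Y)\preccurlyeq M$ and $\mathrm{Cov}(Y')\preccurlyeq M$, one has $E((g(Y)-g(Y'))^{2})\le\kappa^{2}E(\|Y-Y'\|^{2})$, where $\|\cdot\|$ is the Euclidean norm. The matrix $\sqrt{\Lambda}$ is the diagonal matrix with diagonal entries $\sqrt{\lambda_i}$. Algorithm GRDR$(g,M,A,q)$. Its parameters are the function $g$, the matrices $M$ and $A$ with $AA^T=M$, and a vector $q=(q_0,\dots,q_{d-1})\in\mathbb{R}^d$ with $1=q_0\ge q_1\ge\cdots\ge q_{d-1}>0$. (1) Set $n=\left\lceil d\big/\sum_{i=0}^{d-1}q_i\right\rceil$. (2) Simulate $U=(U_1,\dots,U_d)\sim N(0,I_d)$, set $X\leftarrow AU$ and $S\leftarrow g(X)$. (3) For $k=1,\dots,n-1$: simulate a random integer $N\in\{1,\dots,d\}$ with $\Pr(N>i)=q_i$ for $0\le i\le d-1$; simulate $(U'_1,\dots,U'_N)\sim N(0,I_N)$; set $U'\leftarrow(U'_1,\dots,U'_N,U_{N+1},\dots,U_d)$; set $X\leftarrow X+A(U'-U)$; set $S\leftarrow S+g(X)$; set $U\leftarrow U'$. (4) Return $f_n=S/n$.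 All random draws (the integers $N$ in different iterations, the initial vector $U$, and the newly simulated Gaussian components) are independent of each other and of the past. Running time means the number of arithmetic operations; $T$ is its expectation for one run of GRDR, with $A$ and $q$ given as inputs (not counting the time to compute them). Cost conventions: evaluating $g$ at a point takes $O(d)$ time; simulating $k$ independent standard Gaussian variables takes $O(k)$ time; simulating $N$ takes $O(d)$ time; computing $AU$ takes $O(d^2)$ time; in each loop iteration, since the last $d-N$ components of $U'-U$ vanish, the update $X\leftarrow X+A(U'-U)$ is carried out in $O(dN)$ time. The constant $c$ depends only on the constants implied by these cost conventions. *)

(* Defs.v *)
From HB Require Import structures.
From mathcomp Require Import all_boot all_order all_algebra.
From mathcomp Require Import all_classical all_reals all_analysis.

Set Implicit Arguments.
Unset Strict Implicit.
Unset Printing Implicit Defensive.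

Import Order.TTheory GRing.Theory Num.Theory.
Import numFieldNormedType.Exports.

Local Open Scope classical_set_scope.
Local Open Scope ring_scope.

Section Matrices.
Context {R : realType} {d : nat}.
Implicit Types B M : 'M[R]_d.

Definition possemidef B : Prop :=
  B^T = B /\ forall x : 'cV[R]_d, 0 <= (x^T *m B *m x) 0 0.

Definition posdef B : Prop :=
  B^T = B /\ forall x : 'cV[R]_d, x != 0 -> 0 < (x^T *m B *m x) 0 0.

Definition loewner_le B B' : Prop := possemidef (B' - B).

(* The norm that the library puts on matrices is the sup norm. *)
Definition euclidean_norm (x : 'cV[R]_d) : R := Num.sqrt (\sum_i x i 0 ^+ 2).

End Matrices.

Section RandomVectors.
Context {R : realType}.

Definition borel_vec (k : nat) := g_sigma_algebraType (@open 'cV[R]_k).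

Definition mutually_independent {disp : measure_display}
    {Omega : measurableType disp} (P : probability Omega R) {I : finType}
    (X : I -> Omega -> R) : Prop :=
  forall B : I -> set R, (forall i, measurable (B i)) ->
    P (\bigcap_(i in [set: I]) (X i @^-1` B i)) =
    (\prod_(i : I) P (X i @^-1` B i))%E.

Definition standard_normal {disp : measure_display}
    {Omega : measurableType disp} (P : probability Omega R)
    (Z : {RV P >-> R}) : Prop :=
  forall B : set R, measurable B -> P (Z @^-1` B) = normal_prob 0 1 B.

(* W has the law of C *m Z for some matrix C and some vector Z of independent
   standard normal variables, possibly on another probability space. The matrix
   C is arbitrary, so that W may be degenerate. *)
Definition centered_gaussian {disp : measure_display}
    {Omega : measurableType disp} (P : probability Omega R) {k : nat}
    (W : Omega -> 'cV[R]_k) : Prop :=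
  measurable_fun [set: Omega] (W : Omega -> borel_vec k) /\
  exists (m : nat) (C : 'M[R]_(k, m)) (disp' : measure_display)
      (Omega' : measurableType disp') (P' : probability Omega' R)
      (Z : 'I_m -> {RV P' >-> R}),
    [/\ forall i, standard_normal (Z i),
        mutually_independent P' (fun i => Z i : Omega' -> R) &
        forall B : set (borel_vec k), measurable B ->
          P (W @^-1` B) = P' ((fun w => C *m \col_i Z i w) @^-1` B)].

Definition Cov {disp : measure_display} {Omega : measurableType disp}
    (P : probability Omega R) {k : nat} (Y : Omega -> 'cV[R]_k) : 'M[R]_k :=
  \matrix_(i, j) fine (covariance P (fun w => Y w i 0) (fun w => Y w j 0)).

Definition has_law_N0 {disp : measure_display} {Omega : measurableType disp}
    (P : probability Omega R) {k : nat} (M : 'M[R]_k)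
    (X : Omega -> 'cV[R]_k) : Prop :=
  centered_gaussian P X /\ Cov P X = M.

Definition gaussian_lipschitz {d : nat} (kappa : R) (M : 'M[R]_d)
    (g : 'cV[R]_d -> R) : Prop :=
  forall (disp : measure_display) (Omega : measurableType disp)
    (P : probability Omega R) (Y Y' : Omega -> 'cV[R]_d),
  centered_gaussian P (fun w => col_mx (Y w) (Y' w)) ->
  loewner_le (Cov P Y) M -> loewner_le (Cov P Y') M ->
  ('E_P[fun w => ((g (Y w) - g (Y' w)) ^+ 2)%R] <=
   (kappa ^+ 2)%R%:E * 'E_P[fun w => (euclidean_norm (Y w - Y' w) ^+ 2)%R])%E.

Definition gaussian_square_integrable {d : nat} (M : 'M[R]_d)
    (g : 'cV[R]_d -> R) : Prop :=
  forall (disp : measure_display) (Omega : measurableType disp)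
    (P : probability Omega R) (X : Omega -> 'cV[R]_d),
  has_law_N0 P M X -> ('E_P[fun w => (g (X w) ^+ 2)%R] < +oo)%E.

End RandomVectors.

(* Numbers of arithmetic operations used by the subroutines of GRDR. *)
Record cost_model (R : realType) (d : nat) := CostModel {
  time_g : 'cV[R]_d -> nat;   (* evaluating g at a point *)
  time_normals : nat -> nat;  (* simulating k independent standard normals *)
  time_N : nat -> nat;        (* simulating N, as a function of its value *)
  time_AU : nat;              (* computing A *m U *)
  time_update : nat -> nat    (* X <- X + A (U' - U), as a function of N *)
}.

(* The K's are the constants implied by the O(.) of the cost conventions. *)
Record cost_conventions (R : realType) (d : nat) (ct : cost_model R d)
    (Kg Knormals KN KAU Kupdate : R) : Prop := CostConventions {
  time_g_measurable :
    measurable_fun [set: borel_vec d] (time_g ct : borel_vec d -> nat);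
  time_g_le : forall z, (time_g ct z)%:R <= Kg * d%:R;
  time_normals_le : forall k, (0 < k)%N ->
    (time_normals ct k)%:R <= Knormals * k%:R;
  time_N_le : forall m, (0 < m <= d)%N -> (time_N ct m)%:R <= KN * d%:R;
  time_AU_le : (time_AU ct)%:R <= KAU * d%:R ^+ 2;
  time_update_le : forall m, (0 < m <= d)%N ->
    (time_update ct m)%:R <= Kupdate * (d%:R * m%:R)
}.

Section GRDR.
Context {R : realType} {d : nat} (ct : cost_model R d).
Variables (g : 'cV[R]_d -> R) (A : 'M[R]_d) (q : 'I_d -> R).

Definition GRDR_n : nat := `|Num.ceil (d%:R / \sum_(i < d) q i)|%N.

Record GRDR_state := GRDRState {
  st_U : 'cV[R]_d; st_X : 'cV[R]_d; st_S : R; st_time : nat }.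

(* The d.+1 operations are those of the computation of n: d.-1 additions, one
   division and one ceiling. *)
Definition GRDR_init (U : 'cV[R]_d) : GRDR_state :=
  let X := A *m U in
  GRDRState U X (g X) (d.+1 + time_normals ct d + time_AU ct + time_g ct X).

(* Only the first N entries of G are used: they are the N newly simulated
   normals, and only they are charged for. The final 1 is the addition in
   S <- S + g(X). *)
Definition GRDR_step (N : nat) (G : 'cV[R]_d) (st : GRDR_state) : GRDR_state :=
  let U' := \col_(i < d) (if (i < N)%N then G i 0 else st_U st i 0) in
  let X' := st_X st + A *m (U' - st_U st) in
  GRDRState U' X' (st_S st + g X')
    (st_time st +
     (time_N ct N + time_normals ct N + time_update ct N + time_g ct X' + 1)).

Fixpoint GRDR_loop (N : nat -> nat) (G : nat -> 'cV[R]_d) (k : nat)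
    (st : GRDR_state) : GRDR_state :=
  if k is k'.+1 then GRDR_step (N k') (G k') (GRDR_loop N G k' st) else st.

Definition GRDR_final (U : 'cV[R]_d) (N : nat -> nat) (G : nat -> 'cV[R]_d) :=
  GRDR_loop N G GRDR_n.-1 (GRDR_init U).

Definition GRDR_output U N G : R := st_S (GRDR_final U N G) / GRDR_n%:R.

(* The last operation is the division of S by n. *)
Definition GRDR_time U N G : nat := (st_time (GRDR_final U N G) + 1)%N.

Section RandomDraws.
Context {disp : measure_display} {Omega : measurableType disp}.
Context {P : probability Omega R}.
(* Iteration k + 1 draws N k and the row G k; only the indices k < n - 1 are
   constrained or used. *)
Variables (U : 'I_d -> {RV P >-> R}) (N : nat -> {RV P >-> nat}).
Variable (G : nat -> 'I_d -> {RV P >-> R}).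

(* The integers N k are cast to R so that all the draws of one run form a single
   real family; the cast does not change the generated sigma-algebras. *)
Definition GRDR_draws
    (j : 'I_d + ('I_GRDR_n.-1 + 'I_GRDR_n.-1 * 'I_d)) : Omega -> R :=
  match j with
  | inl i => U i
  | inr (inl k) => fun w => (N k w)%:R
  | inr (inr (k, i)) => G k i
  end.

Record GRDR_randomness : Prop := GRDRRandomness {
  draws_U : forall i, standard_normal (U i);
  draws_N_range : forall k : 'I_GRDR_n.-1, forall w, (0 < N k w <= d)%N;
  draws_N_law : forall (k : 'I_GRDR_n.-1) (i : 'I_d),
    P [set w | (i < N k w)%N] = (q i)%:E;
  draws_G : forall (k : 'I_GRDR_n.-1) i, standard_normal (G k i);
  draws_independent : mutually_independent P GRDR_draws
}.

Definition GRDR_random_output (w : Omega) : R :=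
  GRDR_output (\col_i U i w) (fun k => N k w) (fun k => \col_i G k i w).

Definition GRDR_random_time (w : Omega) : R :=
  (GRDR_time (\col_i U i w) (fun k => N k w) (fun k => \col_i G k i w))%:R.

End RandomDraws.
End GRDR.

(* Main.v *)
Require Import Defs.
From HB Require Import structures.
From mathcomp Require Import all_boot all_order all_algebra.
From mathcomp Require Import all_classical all_reals all_analysis.
From mathcomp Require Import measurable_realfun lra ring zify.

(** Write f x = g (A x), and let U^0, U^1, ... be the successive vectors U of the
    algorithm. One iteration redraws the first N coordinates of U, so for j <= k the
    vectors U^j and U^k share the coordinate i exactly when no integer drawn in
    between exceeds i ([source_agree]); coordinates are numbered from 0. By
    independence this has probability (1 - q_i)^(k - j) ([probability_max_le]).

    Given the integers, (U^j, U^k) is a pair of standard Gaussian vectors that share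
    the coordinates from some t on and are otherwise independent
    ([normal_family_path], [ge0_integral_selection2]). Let overlap t be the expectation
    of the product of the values of f at such a pair, and
    gap i = overlap i - overlap (i + 1). As overlap d = (E f)^2, averaging the
    telescoped overlap over the integers gives, in [chain_correlation],
      Cov (f(U^j), f(U^k)) = sum_i gap i * (1 - q_i)^|k - j|.
    These powers sum to at most 2 n / q_i over all j, k < n, whence
      Var f_n <= (2 / n) * sum_i c_i / q_i    as soon as    gap i <= c_i
    ([variance_chain_average]).

    The gap i is half the expectation of a product of two increments of f, each
    produced by redrawing the coordinate i alone ([gap_le]). The arithmetic-geometric
    inequality bounds it by half the expected square of one increment, and the Lipschitz
    condition, applied to the jointly Gaussian pair of images under A, bounds that
    square by 2 kappa^2 lambda_i, because the column i of A has squared length lambda_i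
    ([gaussian_lipschitz_selection]). So c_i = kappa^2 lambda_i is allowed. With
    q_i = sqrt (lambda_i / lambda_0) and n >= d / sum_i q_i the bound becomes the one
    claimed; the choice of q balances the variance against the cost.

    For the running time, the expectation of N is sum_i q_i and
    (n - 1) * sum_i q_i <= d, so that at most d coordinates are renewed on average, each
    at the cost O(d); the n - 1 <= d iterations cost O(d) each besides. *)

Set Implicit Arguments.
Unset Strict Implicit.
Unset Printing Implicit Defensive.

Import Order.TTheory GRing.Theory Num.Theory.
Import numFieldNormedType.Exports.

Local Open Scope classical_set_scope.
Local Open Scope ring_scope.

(** * Borel sets of vectors *)

Section BorelVectors.
Context {R : realType} {k : nat}.

Definition box (B : 'I_k -> set R) : set 'cV[R]_k :=
  [set x | forall i, B i (x i 0)].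

Definition measurable_boxes : set (set 'cV[R]_k) :=
  [set A | exists2 B : 'I_k -> set R, (forall i, measurable (B i)) & A = box B].

Lemma measurable_coord (i : 'I_k) :
  measurable_fun [set: borel_vec k] (fun x : borel_vec (R := R) k => x i 0).
Proof.
apply: (measurability _ (RGenOInfty.measurableE R)) => _ [_ [a ->] <-].
rewrite setTI; apply: sub_sigma_algebra.
have /continuousP := @coord_continuous R k 1 i 0.
by apply; exact: interval_open.
Qed.

Lemma measurable_box (B : 'I_k -> set R) : (forall i, measurable (B i)) ->
  measurable (box B : set (borel_vec k)).
Proof.
move=> mB.
have -> : box B = \bigcap_(i in [set: 'I_k])
    ((fun x : borel_vec k => x i 0) @^-1` B i).
  by apply/seteqP; split=> [x Bx i _|x Bx i]; [exact: Bx|exact: Bx].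
apply: fin_bigcap_measurable => [|i _]; first exact: finite_finset.
by rewrite -[X in measurable X]setTI; apply: measurable_coord.
Qed.

(** The sup norm makes balls into boxes, and those with rational centre and
    radius form a countable base of the topology. *)
Lemma open_sigma_boxes (O : set 'cV[R]_k) : open O -> <<s measurable_boxes >> O.
Proof.
move=> oO.
pose rbox (c : 'cV[rat]_k * rat) : set 'cV[R]_k :=
  box (fun i => `](ratr (c.1 i 0) - ratr c.2), (ratr (c.1 i 0) + ratr c.2)[%classic).
pose F c := if `[< rbox c `<=` O >] then rbox c else set0.
have -> : O = \bigcup_(c in [set: 'cV[rat]_k * rat]) F c.
  apply/seteqP; split=> [x Ox|x [c _]]; last first.
    by rewrite /F; case: asboolP => // h /h.
  move: oO; rewrite openE => /(_ x Ox) /nbhs_ballP [e /= e0 xeO].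
  have [r] : exists r : rat, ratr r \in `]0, (e / 2)[.
    by apply: rat_in_itvoo; rewrite divr_gt0.
  rewrite in_itv/= => /andP[r0 re].
  have cE i : exists q : rat, ratr q \in `](x i 0 - ratr r), (x i 0 + ratr r)[.
    by apply: rat_in_itvoo; rewrite ltrD2l gtrN.
  pose c : 'cV[rat]_k := \col_i projT1 (cid (cE i)).
  have xc i : `|x i 0 - ratr (c i 0)| < ratr r.
    rewrite mxE; case: (cid _) => /= q; rewrite in_itv/= => /andP[h1 h2].
    by rewrite ltr_distlC h1 h2.
  exists (c, r) => //; rewrite /F; case: asboolP => [_ i|].
    rewrite /= in_itv/=; have := xc i.
    by rewrite ltr_distl => /andP[-> ->].
  case=> y ry; apply: xeO; split=> // i j.
  rewrite ord1 /ball/=; have := xc i; have := ry i.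
  rewrite /= in_itv/= -ltr_distl => h1 h2.
  rewrite (le_lt_trans (ler_distD (ratr (c i 0)) _ _))//.
  by rewrite [ltRHS]splitr ltrD// ?(lt_trans h2)// distrC (lt_trans h1).
apply: (@countable_bigcupT_measurable _
  (g_sigma_algebraType measurable_boxes)) => [|c]; first exact: countableP.
rewrite /F; case: asboolP => _; last exact: measurable0.
by apply: sub_sigma_algebra; eexists; last reflexivity; move=> i /=.
Qed.

(** Coordinatewise measurability suffices: preimages of boxes are measurable, and
    boxes generate the Borel sets. *)
Lemma measurable_vec {disp} {T : measurableType disp} (X : T -> 'cV[R]_k) :
  (forall i, measurable_fun [set: T] (fun t => X t i 0)) ->
  measurable_fun [set: T] (X : T -> borel_vec k).
Proof.
move=> mX.
have mXbox A : <<s measurable_boxes >> A -> measurable (X @^-1` A).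
  move=> sA.
  rewrite -[X in measurable X]setTI.
  apply: (@measurability _ _ T (g_sigma_algebraType measurable_boxes) setT X
    measurable_boxes erefl) => //.
  move=> _ [_ [B mB ->] <-].
  rewrite setTI.
  have -> : X @^-1` box B = \bigcap_(i in [set: 'I_k])
      ((fun t => X t i 0) @^-1` B i).
    by apply/seteqP; split=> [x Bx i _|x Bx i]; [exact: Bx|exact: Bx].
  apply: fin_bigcap_measurable => [|i _]; first exact: finite_finset.
  by rewrite -[X in measurable X]setTI; apply: mX.
apply: (@measurability _ _ T (borel_vec k) setT X open erefl) => //.
move=> _ [A oA <-].
by rewrite setTI; apply: mXbox; exact: open_sigma_boxes.
Qed.

(** Boxes are stable under intersection, so the pi-lambda theorem applies. *)
Lemma measure_boxes_unique (m1 m2 : {measure set (borel_vec k) -> \bar R}) :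
  (forall B, (forall i, measurable (B i)) -> m1 (box B) = m2 (box B)) ->
  (m1 setT < +oo)%E ->
  forall A : set (borel_vec k), measurable A -> m1 A = m2 A.
Proof.
move=> m12 m1oo A mA.
have boxT : box (fun=> setT) = [set: 'cV[R]_k] by apply/seteqP; split.
have mboxT : measurable_boxes setT by exists (fun=> setT).
apply: (@g_sigma_algebra_measure_unique _ R (borel_vec k) measurable_boxes _
  (fun=> setT)) => //.
- by move=> _ [B mB ->]; exact: measurable_box.
- by rewrite bigcup_const.
- move=> _ _ [B mB ->] [B' mB' ->]; exists (fun i => B i `&` B' i).
    by move=> i; exact: measurableI.
  by apply/seteqP; split=> [x [h1 h2] i|x h]; split=> // i; case: (h i).
- by move=> _ [B mB ->]; exact: m12.
- move: A mA; apply: smallest_sub; first exact: smallest_sigma_algebra.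
  exact: open_sigma_boxes.
Qed.

End BorelVectors.

(** * Selections from independent normal variables *)

Section RestrictedLaw.
Local Open Scope ereal_scope.
Context {R : realType} {disp disp' : measure_display}.
Context {Omega : measurableType disp} {Omega' : measurableType disp'}.

Lemma ge0_integral_mrestr (mu : {measure set Omega -> \bar R}) (E : set Omega)
    (mE : measurable E) (f : Omega -> \bar R) :
  measurable_fun [set: Omega] f -> (forall w, 0 <= f w) ->
  \int[mrestr mu mE]_w f w = \int[mu]_(w in E) f w.
Proof.
move=> mf f0.
have mEC : measurable (~` E) by exact: measurableC.
rewrite -(setUv E) ge0_integral_setU //=; last 2 first.
  by rewrite setUv.
  by rewrite disj_set2E setICr.
rewrite [X in _ + X]null_set_integral ?adde0 //; last 2 first.
  exact: measurable_funTS.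
  by rewrite /= /mrestr setICl measure0.
apply: (@eq_measure_integral _ _ _ E mu (mrestr mu mE)) => A mA AE.
by rewrite /= /mrestr setIidl.
Qed.

(** Boxes determine a finite measure on vectors, so the law of [X] weighted by
    the event [E] is [P E] times the law of [X']. *)
Lemma ge0_integral_box_law {k : nat} (P : probability Omega R)
    (P' : probability Omega' R) (E : set Omega) (X : Omega -> 'cV[R]_k)
    (X' : Omega' -> 'cV[R]_k) (h : borel_vec k -> \bar R) :
  measurable E ->
  measurable_fun [set: Omega] (X : Omega -> borel_vec k) ->
  measurable_fun [set: Omega'] (X' : Omega' -> borel_vec k) ->
  (forall B, (forall i, measurable (B i)) ->
    P (E `&` X @^-1` box B) = P E * P' (X' @^-1` box B)) ->
  measurable_fun [set: borel_vec k] h -> (forall x, 0 <= h x) ->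
  \int[P]_(w in E) h (X w) = P E * \int[P']_w h (X' w).
Proof.
move=> mE mX mX' XX' mh h0.
have PE0 : (0 <= fine (P E))%R by exact: fine_ge0.
have PEE : (NngNum PE0)%:num%:E = P E by rewrite /= fineK// fin_num_measure.
pose m1 : {measure set (borel_vec k) -> \bar R} := 
  pushforward (mrestr P mE) (X : Omega -> borel_vec k).
pose m2 : {measure set (borel_vec k) -> \bar R} :=
  mscale (NngNum PE0) (pushforward P' (X' : Omega' -> borel_vec k)).
have m12 A : measurable A -> m1 mX A = m2 mX' A.
  apply: measure_boxes_unique => [B mB|].
    by rewrite /m1 /m2/= /mscale PEE /pushforward /= /mrestr setIC XX'.
  by rewrite /m1 /= /pushforward /mrestr preimage_setT setTI ltey_eq fin_num_measure.
transitivity (\int[m1 mX]_x h x).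
  rewrite ge0_integral_pushforward//.
  rewrite preimage_setT ge0_integral_mrestr//; first exact: measurableT_comp.
  by move=> w; exact: h0.
transitivity (\int[m2 mX']_x h x).
  by apply: eq_measure_integral => A mA _; exact: m12.
rewrite ge0_integral_mscale// PEE ge0_integral_pushforward//.
Qed.

End RestrictedLaw.

Section NormalFamilies.
Local Open Scope ereal_scope.
Context {R : realType} {d : nat}.

(** The restriction to an event [E] allows the conditioning on the integers
    drawn by the algorithm. *)
Definition normal_family {disp} {Omega : measurableType disp}
    (P : probability Omega R) (E : set Omega) {S : finType}
    (Z : S -> 'I_d -> Omega -> R) : Prop :=
  [/\ measurable E, forall s i, measurable_fun [set: Omega] (Z s i) &
  forall B : S -> 'I_d -> set R, (forall s i, measurable (B s i)) ->
    P (E `&` [set w | forall s i, B s i (Z s i w)]) =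
    P E * \prod_(i < d) \prod_(s : S) normal_prob 0 1 (B s i)].

(** The choice [a] tells, for each coordinate, which of the copies indexed by [S]
    supplies it. All the Gaussian vectors met below, whether states of the chain or
    vectors built on a product space, are selections of this kind. *)
Definition selection {Omega : Type} {S : finType} (Z : S -> 'I_d -> Omega -> R)
    (a : 'I_d -> S) (w : Omega) : 'cV[R]_d :=
  \col_i Z (a i) i w.

Definition selection2 {Omega : Type} {S : finType} (Z : S -> 'I_d -> Omega -> R)
    (a b : 'I_d -> S) (w : Omega) : 'cV[R]_(d + d) :=
  col_mx (selection Z a w) (selection Z b w).

Section OneFamily.
Context {disp : measure_display} {Omega : measurableType disp}.
Context (P : probability Omega R) (E : set Omega) {S : finType}.
Context (Z : S -> 'I_d -> Omega -> R) (nZ : normal_family P E Z).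

Lemma measurable_selection (a : 'I_d -> S) :
  measurable_fun [set: Omega] (selection Z a : Omega -> borel_vec d).
Proof.
apply: measurable_vec => i; case: nZ => _ mZ _.
by rewrite [X in measurable_fun _ X](_ : _ = Z (a i) i)//; apply/funext => w;
  rewrite mxE.
Qed.

Lemma measurable_selection2 (a b : 'I_d -> S) :
  measurable_fun [set: Omega] (selection2 Z a b : Omega -> borel_vec (d + d)).
Proof.
apply: measurable_vec => i; case: nZ => _ mZ _.
case: (split_ordP i) => j ->.
  by rewrite [X in measurable_fun _ X](_ : _ = Z (a j) j)//; apply/funext => w;
    rewrite col_mxEu mxE.
by rewrite [X in measurable_fun _ X](_ : _ = Z (b j) j)//; apply/funext => w;
  rewrite col_mxEd mxE.
Qed.

(** A coordinate on which [a] and [b] agree is one normal variable constrained to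
    lie in two sets; otherwise the two constraints bear on independent variables. *)
Lemma selection2_box (a b : 'I_d -> S) (B : 'I_(d + d) -> set R) :
  (forall i, measurable (B i)) ->
  P (E `&` selection2 Z a b @^-1` box B) =
  P E * \prod_(i < d)
    (if a i == b i then normal_prob 0 1 (B (lshift d i) `&` B (rshift d i))
     else normal_prob 0 1 (B (lshift d i)) * normal_prob 0 1 (B (rshift d i))).
Proof.
move=> mB.
pose C s i : set R := (if a i == s then B (lshift d i) else setT) `&`
  (if b i == s then B (rshift d i) else setT).
have mC s i : measurable (C s i).
  by apply: measurableI; case: ifP.
have -> : selection2 Z a b @^-1` box B = [set w | forall s i, C s i (Z s i w)].
  apply/seteqP; split=> [w /= h s i|w /= h i].
    split; case: eqP => // <-.
      by have := h (lshift d i); rewrite /selection2 col_mxEu mxE.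
    by have := h (rshift d i); rewrite /selection2 col_mxEd mxE.
  rewrite /selection2; case: (split_ordP i) => j ->.
    by rewrite col_mxEu mxE; case: (h (a j) j); rewrite eqxx.
  by rewrite col_mxEd mxE; case: (h (b j) j) => _; rewrite eqxx.
case: nZ => _ _ ->//; congr (_ * _).
apply: eq_bigr => i _; rewrite (bigD1 (a i))//=.
have [ab|ab] := eqVneq (a i) (b i).
  rewrite big1 ?mule1 /C; first by rewrite -ab eqxx.
  move=> s sa; rewrite -ab eq_sym (negbTE sa) setTI.
  exact: probability_setT.
rewrite (bigD1 (b i))/= 1?eq_sym// big1 ?mule1 /C => [|s /andP[sa sb]].
  by rewrite !eqxx eq_sym (negbTE ab) setTI setIT.
rewrite eq_sym (negbTE sa) eq_sym (negbTE sb) setTI.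
exact: probability_setT.
Qed.

End OneFamily.

(** By [selection2_box] the probabilities of boxes involve only the set of
    coordinates on which the two selections agree. Thus the states of the chain,
    given the integers drawn, can be replaced by vectors on a product space. *)
Lemma ge0_integral_selection2
    {disp disp'} {Omega : measurableType disp} {Omega' : measurableType disp'}
    (P : probability Omega R) (P' : probability Omega' R) (E : set Omega)
    {S S' : finType} (Z : S -> 'I_d -> Omega -> R)
    (Z' : S' -> 'I_d -> Omega' -> R)
    (a b : 'I_d -> S) (a' b' : 'I_d -> S') (h : borel_vec (d + d) -> \bar R) :
  normal_family P E Z -> normal_family P' setT Z' ->
  (forall i, (a i == b i) = (a' i == b' i)) ->
  measurable_fun [set: borel_vec (d + d)] h -> (forall x, 0 <= h x) ->
  \int[P]_(w in E) h (selection2 Z a b w) = P E * \int[P']_w h (selection2 Z' a' b' w).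
Proof.
move=> nZ nZ' ab mh h0; apply: ge0_integral_box_law => //.
- by case: nZ.
- exact: measurable_selection2 nZ _ _.
- exact: measurable_selection2 nZ' _ _.
- move=> B mB; rewrite (selection2_box nZ)// -[in RHS](setTI (_ @^-1` _)).
  rewrite (selection2_box nZ')// probability_setT mul1e; congr (_ * _).
  by apply: eq_bigr => i _; rewrite ab.
Qed.

Lemma integrable_selection2
    {disp disp'} {Omega : measurableType disp} {Omega' : measurableType disp'}
    (P : probability Omega R) (P' : probability Omega' R) (E : set Omega)
    {S S' : finType} (Z : S -> 'I_d -> Omega -> R)
    (Z' : S' -> 'I_d -> Omega' -> R)
    (a b : 'I_d -> S) (a' b' : 'I_d -> S') (h : borel_vec (d + d) -> R) :
  normal_family P E Z -> normal_family P' setT Z' ->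
  (forall i, (a i == b i) = (a' i == b' i)) ->
  measurable_fun [set: borel_vec (d + d)] h ->
  P'.-integrable setT (fun w => (h (selection2 Z' a' b' w))%:E) ->
  P.-integrable E (fun w => (h (selection2 Z a b w))%:E).
Proof.
move=> nZ nZ' ab mh /integrableP[_ hoo]; apply/integrableP; split.
  apply/measurable_EFinP/measurable_funTS.
  exact: measurableT_comp mh (measurable_selection2 nZ a b).
rewrite (@ge0_integral_selection2 _ _ _ _ _ P' E _ _ Z Z' a b a' b'
  (fun x => `|(h x)%:E|))//; last first.
  by apply: measurableT_comp => //; exact/measurable_EFinP.
by rewrite lte_mul_pinfty// fin_num_measure//; case: nZ.
Qed.

(** The positive and negative parts reduce the signed case to
    [ge0_integral_selection2]. *)
Lemma Rintegral_selection2
    {disp disp'} {Omega : measurableType disp} {Omega' : measurableType disp'}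
    (P : probability Omega R) (P' : probability Omega' R) (E : set Omega)
    {S S' : finType} (Z : S -> 'I_d -> Omega -> R)
    (Z' : S' -> 'I_d -> Omega' -> R)
    (a b : 'I_d -> S) (a' b' : 'I_d -> S') (h : borel_vec (d + d) -> R) :
  normal_family P E Z -> normal_family P' setT Z' ->
  (forall i, (a i == b i) = (a' i == b' i)) ->
  measurable_fun [set: borel_vec (d + d)] h ->
  P'.-integrable setT (fun w => (h (selection2 Z' a' b' w))%:E) ->
  (\int[P]_(w in E) h (selection2 Z a b w) =
    fine (P E) * \int[P']_w h (selection2 Z' a' b' w))%R.
Proof.
move=> nZ nZ' ab mh ih.
have mE : measurable E by case: nZ.
rewrite /Rintegral -fineM ?integrable_fin_num// ?fin_num_measure//; congr fine.
have mEh : measurable_fun [set: borel_vec (d + d)] (EFin \o h).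
  exact/measurable_EFinP.
have transfer f : measurable_fun [set: borel_vec (d + d)] f ->
    (forall x, 0 <= f x) ->
    \int[P]_(w in E) f (selection2 Z a b w) =
    P E * \int[P']_w f (selection2 Z' a' b' w).
  exact: ge0_integral_selection2 nZ nZ' ab.
have tpos := transfer _ (measurable_funepos mEh) (funepos_ge0 _).
have tneg := transfer _ (measurable_funeneg mEh) (funeneg_ge0 _).
rewrite integralE [in RHS]integralE muleBr ?fin_num_measure//.
  have E1 := funepos_comp (EFin \o h) (selection2 Z a b).
  have E2 := funepos_comp (EFin \o h) (selection2 Z' a' b').
  have E3 := funeneg_comp (EFin \o h) (selection2 Z a b).
  have E4 := funeneg_comp (EFin \o h) (selection2 Z' a' b').
  rewrite /comp/= in E1 E2 E3 E4; rewrite E1 E2 E3 E4.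
  by congr (_ - _); [exact: tpos|exact: tneg].
by rewrite fin_num_adde_defr// integrable_pos_fin_num.
Qed.

End NormalFamilies.

(** * Moments of the standard normal law *)

Section NormalMoments.
Context {R : realType}.
Local Notation mu := (@lebesgue_measure R).
Local Notation gamma := (normal_prob (0 : R) 1).
Local Notation phi := (normal_pdf (0 : R) 1).

(** The density of the normal law is almost everywhere its Radon-Nikodym
    derivative, which reduces the claim to the change of variables formula. *)
Lemma ge0_integral_normal_prob (f : R -> \bar R) :
  measurable_fun [set: R] f -> (forall x, (0 <= f x)%E) ->
  (\int[gamma]_x f x = \int[mu]_x (f x * (phi x)%:E))%E.
Proof.
move=> mf f0; have dom := @normal_prob_dominates R 0 1.
have mphi : measurable_fun [set: R] (EFin \o phi).
  by apply/measurable_EFinP; exact: measurable_normal_pdf.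
have iRN := Radon_Nikodym_SigmaFinite.f_integrable dom.
rewrite -(Radon_Nikodym_SigmaFinite.change_of_variables dom)//.
apply: ae_eq_integral => //.
- by apply: emeasurable_funM => //; exact: measurable_int iRN.
- exact: emeasurable_funM.
- apply: ae_eqe_mul2l; apply: integral_ae_eq => // A _ mA.
  by rewrite -Radon_Nikodym_SigmaFinite.f_integral.
Qed.

Let scaleRE (a b : R) : a *: b = a * b. Proof. by []. Qed.

Lemma standard_pdfE x : phi x = normal_peak 1 * expR (- (x ^+ 2 / 2)).
Proof.
by rewrite normal_pdfE ?oner_neq0// /normal_fun subr0 expr1n mulNr.
Qed.

Lemma standard_pdfN x : phi (- x) = phi x.
Proof. by rewrite !standard_pdfE sqrrN. Qed.

Lemma is_derive_standard_pdf (x : R) : is_derive x 1 phi (- (x * phi x)).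
Proof.
have -> : phi = (fun x : R => normal_peak 1 * expR (- (x ^+ 2 / 2))).
  by apply/funext => y; exact: standard_pdfE.
have -> : - (x * (normal_peak 1 * expR (- (x ^+ 2 / 2)))) =
    normal_peak 1 *: (expR (- (x ^+ 2 / 2)) * (- x)) by rewrite ?scaleRE/=; ring.
apply: is_deriveZ; apply: is_derive1_comp.
have -> : (fun x : R => - (x ^+ 2 / 2)) = (- 2^-1) \*: (id ^+ 2).
  by apply/funext => y; rewrite !fctE /= ?scaleRE; field.
have h := is_deriveZ (- 2^-1 : R) (is_deriveX 2 (is_derive_id x (1 : R))).
apply: is_derive_eq.
by rewrite ?scaleRE/= expr1; field.
Qed.

Lemma is_derive_id_standard_pdf (x : R) :
  is_derive x 1 (fun y => y * phi y) ((1 - x ^+ 2) * phi x).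
Proof.
have h := is_deriveM (is_derive_id x 1) (is_derive_standard_pdf x).
apply: is_derive_eq.
by rewrite ?scaleRE/=; ring.
Qed.

Lemma cvg_id_standard_pdf : x * phi x @[x --> +oo%R] --> 0.
Proof.
apply: (@squeeze_cvgr _ _ _ _ (cst 0) (fun x : R => normal_peak 1 * 2 * x^-1)).
- near=> x; have x0 : 0 < x by near: x; exact: nbhs_pinfty_gt.
  rewrite mulr_ge0 ?(ltW x0)//= ?normal_pdf_ge0//.
  rewrite standard_pdfE mulrCA -mulrA ler_wpM2l ?normal_peak_ge0//.
  rewrite expRN ler_pdivlMr// mulrAC ler_pdivrMr ?expR_gt0// -expr2.
  by have := expR_ge1Dx (x ^+ 2 / 2); lra.
- exact: cvg_cst.
- rewrite -(mulr0 (normal_peak 1 * 2)); apply: cvgM; first exact: cvg_cst.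
  apply/gtr0_cvgV0; last exact: cvg_id.
  exact: nbhs_pinfty_gt.
Unshelve. all: by end_near. Qed.

(** Integration by parts: [x * phi x] is a primitive of [(1 - x ^+ 2) * phi x] and
    vanishes at [0] and at infinity. The half-line is cut at [1], where the integrand
    changes sign, so that only integrals of nonnegative functions occur. *)
Lemma standard_normal_moment2 : (\int[gamma]_x (x ^+ 2)%:E = 1)%E.
Proof.
have cphi : continuous phi by apply: continuous_normal_pdf; rewrite oner_neq0.
have phi0 x : 0 <= phi x by exact: normal_pdf_ge0.
have csqr : continuous (fun x : R => x ^+ 2) by exact: exprn_continuous.
have cq : continuous (fun x : R => x ^+ 2 * phi x).
  by move=> x; apply: cvgM; [exact: csqr|exact: cphi].
have c1q : continuous (fun x : R => (1 - x ^+ 2) * phi x).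
  move=> x; apply: cvgM; last exact: cphi.
  by apply: cvgB; [exact: cvg_cst|exact: csqr].
have cq1 : continuous (fun x : R => (x ^+ 2 - 1) * phi x).
  move=> x; apply: cvgM; last exact: cphi.
  by apply: cvgB; [exact: csqr|exact: cvg_cst].
have cF : continuous (fun x : R => x * phi x).
  by move=> x; apply: cvgM; [exact: cvg_id|exact: cphi].
have mfun (f : R -> R) (D : set R) : continuous f -> measurable D ->
    measurable_fun D (EFin \o f).
  move=> cf mD; apply/measurable_EFinP/measurable_funTS.
  exact: continuous_measurable_fun.
have q0 x : 0 <= x ^+ 2 * phi x by rewrite mulr_ge0 ?sqr_ge0.
rewrite ge0_integral_normal_prob; last 2 first.
- exact: mfun.
- by move=> x; rewrite lee_fin sqr_ge0.
have half : (\int[mu]_(x in [set x | (0 <= x)%R]) (x ^+ 2 * phi x)%:E =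
    \int[mu]_(x in [set x | (0 <= x)%R]) (phi x)%:E)%E.
  have -> : [set x : R | 0 <= x] = `[0, 1]%classic `|` `]1, +oo[%classic.
    apply/seteqP; split=> x /=; rewrite !in_itv/= andbT.
      by move=> x0; case: (leP x 1) => h; [left|right]; rewrite ?x0.
    by move=> [/andP[]//|/ltW]; exact: le_trans.
  have disj : [disjoint `[0, 1]%classic & `]1, +oo[%classic : set R].
    rewrite disj_set2E; apply/eqP; rewrite -subset0 => x [] /=.
    by rewrite !in_itv/= andbT => /andP[_ x1] /(le_lt_trans x1); rewrite ltxx.
  rewrite !ge0_integral_setU//=; try by [apply: mfun => //; exact: measurableU|
    move=> x _; rewrite lee_fin].
  have -> : (\int[mu]_(x in `[0%R, 1%R]) (phi x)%:E =
      \int[mu]_(x in `[0%R, 1%R]) (x ^+ 2 * phi x)%:E + (phi 1)%:E)%E.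
    have <- : (\int[mu]_(x in `[0%R, 1%R]) ((1 - x ^+ 2) * phi x)%:E = (phi 1)%:E)%E.
      rewrite (@continuous_FTC2 _ _ (fun x : R => x * phi x))//.
      - by rewrite mul0r mul1r sube0.
      - exact: continuous_subspaceT.
      - split=> [x _||].
        + by have := is_derive_id_standard_pdf x; case.
        + exact/cvg_at_right_filter/cF.
        + exact/cvg_at_left_filter/cF.
      - move=> x _; rewrite derive1E.
        by have := is_derive_id_standard_pdf x => /@derive_val ->.
    rewrite -ge0_integralD//=.
    - by apply: eq_integral => x _; rewrite -EFinD; congr (_%:E); ring.
    - by move=> x _; rewrite lee_fin.
    - exact: (mfun _ _ cq).
    - move=> x; rewrite in_itv/= => /andP[x0 x1].
      by rewrite lee_fin mulr_ge0// subr_ge0 expr_le1.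
    - exact: (mfun _ _ c1q).
  rewrite -[RHS]addeA; congr +%E.
  rewrite !integral_itv_obnd_cbnd; [|exact: (mfun _ _ cphi)|exact: (mfun _ _ cq)].
  have <- : (\int[mu]_(x in `[1%R, +oo[) ((x ^+ 2 - 1) * phi x)%:E = (phi 1)%:E)%E.
    have dF (x : R) : is_derive x 1 (- (fun y : R => y * phi y)) ((x ^+ 2 - 1) * phi x).
      have h := is_deriveN (is_derive_id_standard_pdf x).
      by apply: is_derive_eq; rewrite -mulNr opprB.
    rewrite (@ge0_continuous_FTC2y _ _ (- (fun x : R => x * phi x)) _ 0).
    - by rewrite fctE mul1r EFinN oppeK add0e.
    - by move=> x x1; rewrite mulr_ge0// subr_ge0 exprn_ege1.
    - exact: continuous_subspaceT.
    - by have := cvgN cvg_id_standard_pdf; rewrite oppr0; exact.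
    - by move=> x _; case: (dF x).
    - by apply/cvg_at_right_filter; apply: cvgN; exact: cF.
    - by move=> x _; rewrite derive1E; have := dF x => /@derive_val ->.
  rewrite -ge0_integralD//=.
  - by apply: eq_integral => x _; rewrite -EFinD; congr (_%:E); ring.
  - move=> x; rewrite in_itv/= andbT => x1.
    by rewrite lee_fin mulr_ge0// subr_ge0 exprn_ege1.
  - exact: (mfun _ _ cq1).
  - by move=> x _; rewrite lee_fin.
  - exact: (mfun _ _ cphi).
transitivity (\int[mu]_x (x ^+ 2 * phi x)%:E)%E.
  by apply: eq_integral => x _; rewrite EFinM.
rewrite ge0_symfun_integralT// => [|x]; last by rewrite /= sqrrN standard_pdfN.
rewrite half -ge0_symfun_integralT// ?integral_normal_pdf// => x.
by rewrite /= standard_pdfN.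
Qed.

Lemma ge0_integral_standard_normalN (f : R -> \bar R) :
  measurable_fun [set: R] f -> (forall x, (0 <= f x)%E) ->
  (\int[gamma]_x f (- x)%R = \int[gamma]_x f x)%E.
Proof.
move=> mf f0.
have mfN : measurable_fun [set: R] (fun x : R => f (- x)).
  exact: measurableT_comp.
have mfphi : measurable_fun [set: R] (fun x : R => (f x * (phi x)%:E)%E).
  apply: emeasurable_funM => //; apply/measurable_EFinP.
  exact: measurable_normal_pdf.
rewrite !ge0_integral_normal_prob//.
pose opp : measurableTypeR R -> measurableTypeR R := -%R.
have mopp : measurable_fun [set: measurableTypeR R] opp by exact: oppr_measurable.
have fphi0 x : (0 <= f x * (phi x)%:E)%E.
  by rewrite mule_ge0// lee_fin normal_pdf_ge0.
have push := @ge0_integral_pushforward _ _ _ _ R opp mopp mu setT _ measurableT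
  mfphi (fun x _ => fphi0 x).
transitivity (\int[pushforward mu opp]_x (f x * (phi x)%:E))%E.
  rewrite push; apply: eq_integral => x _.
  by rewrite /= /opp standard_pdfN.
by apply: eq_measure_integral => A mA _; exact: lebesgue_measureN.
Qed.

End NormalMoments.

(** * Orthonormality of independent normal variables *)

Section SquareIntegrable.
Context {R : realType} {disp : measure_display} {Omega : measurableType disp}.
Variable P : probability Omega R.

Lemma Lfun2P (X : Omega -> R) : measurable_fun [set: Omega] X ->
  (\int[P]_w (X w ^+ 2)%:E < +oo)%E -> X \in Lfun P 2%:E.
Proof.
move=> mX Xoo; rewrite inE; apply/andP; split; rewrite inE//=.
rewrite /finite_norm unlock poweR_lty//.
rewrite (eq_integral (fun w => (X w ^+ 2)%:E))// => w _.
by rewrite abse_EFin poweR_EFin powR_mulrn// real_normK// num_real.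
Qed.

Lemma Lfun2_Lfun1 (X : Omega -> R) : X \in Lfun P 2%:E -> X \in Lfun P 1.
Proof. by apply: Lfun_subset12; rewrite fin_num_measure. Qed.

Lemma Lfun2_integrable (X : Omega -> R) : X \in Lfun P 2%:E ->
  P.-integrable setT (fun w => (X w)%:E).
Proof. by move=> /Lfun2_Lfun1 /Lfun1_integrable. Qed.

Lemma Lfun2_integrableM (X Y : Omega -> R) :
  X \in Lfun P 2%:E -> Y \in Lfun P 2%:E ->
  P.-integrable setT (fun w => (X w * Y w)%:E).
Proof. by move=> lX lY; have /Lfun1_integrable := Lfun2_mul_Lfun1 lX lY. Qed.

Lemma integrable_sum_EFin (D : set Omega) {I : Type} (s : seq I)
    (X : I -> Omega -> R) : measurable D ->
  (forall i, P.-integrable D (fun w => (X i w)%:E)) ->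
  P.-integrable D (fun w => (\sum_(i <- s) X i w)%:E).
Proof.
move=> mD iX; under eq_fun do rewrite -sumEFin.
by apply: integrable_sum => // i _; exact: iX.
Qed.

Lemma Rintegral_sum (D : set Omega) {I : Type} (s : seq I) (X : I -> Omega -> R) :
  measurable D ->
  (forall i, P.-integrable D (fun w => (X i w)%:E)) ->
  \int[P]_(w in D) (\sum_(i <- s) X i w) = \sum_(i <- s) \int[P]_(w in D) X i w.
Proof.
move=> mD iX; rewrite /Rintegral.
rewrite (eq_integral (fun w => (\sum_(i <- s) (X i w)%:E)%E)); last first.
  by move=> w _; rewrite sumEFin.
rewrite integral_sum// -[RHS]/(fine (EFin _)) -sumEFin; congr fine.
by apply: eq_bigr => i _; rewrite fineK// integrable_fin_num.
Qed.

Lemma expectationE (X : Omega -> R) : P.-integrable setT (fun w => (X w)%:E) ->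
  ('E_P[X] = (\int[P]_w X w)%:E)%E.
Proof. by move=> iX; rewrite unlock /Rintegral fineK// integrable_fin_num. Qed.

End SquareIntegrable.

Section NormalFamilyMoments.
Context {R : realType} {d : nat} {disp : measure_display}.
Context {Omega : measurableType disp} {P : probability Omega R} {S : finType}.
Context {Z : S -> 'I_d -> Omega -> R} (nZ : normal_family P setT Z).
Local Notation gamma := (normal_prob (0 : R) 1).

Lemma normal_family_law s i (B : set R) : measurable B ->
  P (Z s i @^-1` B) = gamma B.
Proof.
move=> mB; case: nZ => _ _.
move=> /(_ (fun t j => if (t == s) && (j == i) then B else setT)).
rewrite probability_setT mul1e setTI => nZB.
have -> : Z s i @^-1` B =
    [set w | forall t j, (if (t == s) && (j == i) then B else setT) (Z t j w)].
  apply/seteqP; split=> w /=; last by move=> /(_ s i); rewrite !eqxx.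
  by move=> Bw t j; case: andP => // -[/eqP -> /eqP ->].
rewrite nZB => [|t j]; last by case: ifP.
rewrite (bigD1 i)//= (bigD1 s)//= !eqxx/= !big1 ?mule1//.
  move=> j ji; rewrite big1// => t _.
  by rewrite (negbTE ji) andbF probability_setT.
by move=> t ts; rewrite (negbTE ts) probability_setT.
Qed.

Lemma ge0_integral_normal_family s i (f : R -> \bar R) :
  measurable_fun [set: R] f -> (forall x, (0 <= f x)%E) ->
  (\int[P]_w f (Z s i w) = \int[gamma]_x f x)%E.
Proof.
move=> mf f0.
have mZ : measurable_fun [set: Omega] (Z s i) by case: nZ.
transitivity (\int[pushforward P (Z s i : Omega -> measurableTypeR R)]_x f x)%E.
  by rewrite ge0_integral_pushforward.
by apply: eq_measure_integral => A mA _; exact: normal_family_law.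
Qed.

Lemma normal_family_sqr s i : (\int[P]_w (Z s i w ^+ 2)%:E = 1)%E.
Proof.
rewrite (ge0_integral_normal_family s i (f := fun x => (x ^+ 2)%:E)).
- exact: standard_normal_moment2.
- exact/measurable_EFinP/measurable_funX.
- by move=> x; rewrite lee_fin sqr_ge0.
Qed.

Lemma normal_family_Lfun2 s i : Z s i \in Lfun P 2%:E.
Proof.
apply: Lfun2P; first by case: nZ.
by rewrite normal_family_sqr ltry.
Qed.

End NormalFamilyMoments.

Section SignFlip.
Context {R : realType} {d : nat} {disp : measure_display}.
Context {Omega : measurableType disp} {P : probability Omega R} {S : finType}.
Context {Z : S -> 'I_d -> Omega -> R} (nZ : normal_family P setT Z).
Local Notation gamma := (normal_prob (0 : R) 1).

Lemma standard_normalN (B : set R) : measurable B ->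
  gamma (-%R @^-1` B) = gamma B.
Proof.
move=> mB.
have mNB : measurable (-%R @^-1` B : set R).
  by rewrite -[X in measurable X]setTI; exact: oppr_measurable.
rewrite -[in RHS](setIT B) -[in LHS](setIT (_ @^-1` B)).
rewrite -!integral_indic//.
rewrite -[RHS](@ge0_integral_standard_normalN R (fun x => (\1_B x)%:E))//.
exact/measurable_EFinP/measurable_indic.
Qed.

(** Changing the sign of one variable preserves the law of the family by symmetry
    of the normal law, hence expectations that are odd in that variable vanish. *)
Definition sign_flip (t : S) (j : 'I_d) (s : S) (i : 'I_d) (w : Omega) : R :=
  if (s == t) && (i == j) then - Z s i w else Z s i w.

Lemma normal_family_sign_flip t j : normal_family P setT (sign_flip t j).
Proof.
case: nZ => _ mZ ZB; split=> // [s i|B mB].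
  rewrite /sign_flip; case: (_ && _) => //.
  by apply: measurableT_comp => //; exact: oppr_measurable.
pose B' s i := if (s == t) && (i == j) then -%R @^-1` B s i else B s i.
have mB' s i : measurable (B' s i : set R).
  rewrite /B'; case: (_ && _) => //.
  by rewrite -[X in measurable X]setTI; exact: oppr_measurable.
have -> : [set w | forall s i, B s i (sign_flip t j s i w)] =
    [set w | forall s i, B' s i (Z s i w)].
  apply/seteqP; rewrite /sign_flip /B'.
  by split=> w /= h s i; move: (h s i); case: (_ && _).
rewrite ZB//; congr (_ * _)%E; apply: eq_bigr => i _; apply: eq_bigr => s _.
by rewrite /B'; case: (_ && _) => //; rewrite standard_normalN.
Qed.

Lemma normal_family_mean s i : \int[P]_w Z s i w = 0.
Proof.
have iZ : P.-integrable setT (fun w => (Z s i w)%:E).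
  exact/Lfun2_integrable/(normal_family_Lfun2 nZ).
have := @Rintegral_selection2 R d _ _ _ _ P P setT S S (sign_flip s i) Z
  (fun=> s) (fun=> s)
  (fun=> s) (fun=> s) (fun x => x (lshift d i) 0) (normal_family_sign_flip s i) nZ
  (fun=> erefl) (measurable_coord _).
rewrite /selection2; under eq_fun do rewrite col_mxEu mxE.
move=> /(_ iZ).
under eq_Rintegral do rewrite col_mxEu mxE /sign_flip !eqxx/=.
rewrite probability_setT mul1r.
under [in X in _ = X -> _]eq_Rintegral do rewrite col_mxEu mxE.
under eq_Rintegral do rewrite -mulN1r.
rewrite RintegralZl// mulN1r => /eqP.
by rewrite eq_sym -subr_eq0 opprK -mulr2n mulrn_eq0/= => /eqP.
Qed.

Lemma normal_family_uncorrelated s i t j : (s, i) != (t, j) ->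
  \int[P]_w (Z s i w * Z t j w) = 0.
Proof.
move=> sitj.
have iZ : P.-integrable setT (fun w => (Z s i w * Z t j w)%:E).
  by apply: Lfun2_integrableM; exact: (normal_family_Lfun2 nZ).
have := @Rintegral_selection2 R d _ _ _ _ P P setT S S (sign_flip t j) Z
  (fun=> s) (fun=> t)
  (fun=> s) (fun=> t) (fun x => x (lshift d i) 0 * x (rshift d j) 0)
  (normal_family_sign_flip t j) nZ (fun=> erefl).
move=> /(_ (measurable_funM (measurable_coord _) (measurable_coord _))).
rewrite /selection2; under eq_fun do rewrite col_mxEu col_mxEd !mxE.
move=> /(_ iZ).
under eq_Rintegral do
  rewrite col_mxEu col_mxEd !mxE /sign_flip -xpair_eqE (negbTE sitj) !eqxx/= mulrN.
rewrite probability_setT mul1r.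
under [in X in _ = X -> _]eq_Rintegral do rewrite col_mxEu col_mxEd !mxE.
under eq_Rintegral do rewrite -mulN1r.
rewrite RintegralZl// mulN1r => /eqP.
by rewrite eq_sym -subr_eq0 opprK -mulr2n mulrn_eq0/= => /eqP.
Qed.

End SignFlip.

(** * Gaussian vectors and the Lipschitz condition *)

Section ProductFamily.
Context {R : realType} {d : nat} {disp : measure_display}.
Context {Omega : measurableType disp} {P : probability Omega R}.
Context {U : 'I_d -> Omega -> R}.
Hypothesis nU : normal_family P setT (fun _ : unit => U).

(** Two independent copies of the family, on the product space. They supply the
    auxiliary vectors that the given probability space may be too small to carry. *)
Definition two_copies (s : bool) (i : 'I_d) (w : Omega * Omega) : R :=
  U i (if s then w.2 else w.1).

Lemma normal_family_two_copies : normal_family (P \x P)%E setT two_copies.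
Proof.
case: nU => _ mU UB; split=> // [s i|B mB]; rewrite /two_copies.
  by case: s; apply: (measurableT_comp (mU tt i)).
pose A s : set Omega := [set w | forall (u : unit) i, B s i (U i w)].
have -> : [set w : Omega * Omega | forall s i,
    B s i (U i (if s then w.2 else w.1))] = A false `*` A true.
  apply/seteqP; split=> w /=; first by move=> h; split=> _ i; exact: (h _ i).
  by move=> [h1 h2] [] i; [exact: (h2 tt i)|exact: (h1 tt i)].
have mA s : measurable (A s).
  have -> : A s = \bigcap_(i in [set: 'I_d]) (U i @^-1` B s i).
    by apply/seteqP; split=> w /= h; [move=> i _; exact: (h tt i)|
      move=> _ i; exact: h].
  apply: fin_bigcap_measurable => [|i _]; first exact: finite_finset.
  by rewrite -[X in measurable X]setTI; apply: (mU tt).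
rewrite setTI probability_setT mul1e.
transitivity (P (A false) * P (A true))%E.
  exact: (product_measure1E P P (mA false) (mA true)).
have PA s : P (A s) = (\prod_(i < d) normal_prob 0 1 (B s i))%E.
  rewrite -(setTI (A s)) (UB (fun _ => B s))// probability_setT mul1e.
  by apply: eq_bigr => i _; rewrite big_const card_unit /= mule1.
rewrite !PA -big_split/=; apply: eq_bigr => i _.
by rewrite big_bool muleC.
Qed.

End ProductFamily.

Lemma measurable_mulmx {R : realType} {k m : nat} (C : 'M[R]_(k, m)) {disp}
    {T : measurableType disp} (X : T -> 'cV[R]_m) :
  measurable_fun [set: T] (X : T -> borel_vec m) ->
  measurable_fun [set: T] ((fun t => C *m X t) : T -> borel_vec k).
Proof.
move=> mX; apply: measurable_vec => i.
have -> : (fun t => (C *m X t) i 0) = (fun t => \sum_j C i j * X t j 0).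
  by apply/funext => t; rewrite mxE.
apply: measurable_sum => j; apply: measurable_funM => //.
exact: measurableT_comp (measurable_coord j) mX.
Qed.

Section GaussianSelections.
Context {R : realType} {d : nat} {disp : measure_display}.
Context {Omega : measurableType disp} {P : probability Omega R}.
Context {Z : bool -> 'I_d -> Omega -> R} (nZ : normal_family P setT Z).
Implicit Types a b : 'I_d -> bool.

Lemma centered_gaussian_selection2 {k} (C : 'M[R]_(k, d + d)) :
  centered_gaussian P (fun w => C *m selection2 Z xpred0 xpredT w).
Proof.
have mX := measurable_selection2 nZ xpred0 xpredT.
split; first exact: measurable_mulmx.
have mXi i := measurableT_comp (measurable_coord i) mX.
pose X i : {RV P >-> R} := HB.pack (fun w => selection2 Z xpred0 xpredT w i 0)
  (isMeasurableFun.Build _ _ _ _ _ (mXi i)).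
have XB i B : measurable B -> P (X i @^-1` B) = normal_prob 0 1 B.
  move=> mB; case: (split_ordP i) => j ->.
    rewrite -(normal_family_law nZ false j mB); congr (P _).
    by apply/seteqP; split=> w /=; rewrite /selection2 col_mxEu mxE.
  rewrite -(normal_family_law nZ true j mB); congr (P _).
  by apply/seteqP; split=> w /=; rewrite /selection2 col_mxEd mxE.
exists (d + d)%N, C, disp, Omega, P, X; split.
- by move=> i B; exact: XB.
- move=> B mB.
  have -> : \bigcap_(i in [set: 'I_(d + d)]) (X i @^-1` B i) =
      setT `&` selection2 Z xpred0 xpredT @^-1` box B.
    rewrite setTI; apply/seteqP; split=> w /= h; first by move=> i; exact: h.
    by move=> i _; exact: h.
  rewrite (selection2_box nZ)// probability_setT mul1e/= big_split/=.
  rewrite big_split_ord/=; congr (_ * _)%E; apply: eq_bigr => i _;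
    by rewrite XB.
- move=> B mB; congr (P _); apply/funext => w /=.
  have -> // : \col_i X i w = selection2 Z xpred0 xpredT w.
  by apply/colP => i; rewrite mxE.
Qed.

(** A selection is linear in the concatenation of the two copies; exhibiting the
    matrix is what makes two selections jointly Gaussian. *)
Definition selector a : 'M[R]_(d, d + d) :=
  row_mx (diag_mx (\row_i (~~ a i)%:R)) (diag_mx (\row_i (a i)%:R)).

Lemma selection_selector a w :
  selection Z a w = selector a *m selection2 Z xpred0 xpredT w.
Proof.
apply/colP => i; rewrite /selector /selection2 mul_row_col !mxE.
rewrite (bigD1 i)//= big1 ?addr0 => [|j ji]; last first.
  by rewrite !mxE eq_sym (negbTE ji) mulr0n mul0r.
rewrite [X in _ + X](bigD1 i)//= [X in _ + (_ + X)]big1 ?addr0 => [|j ji]; last first.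
  by rewrite !mxE eq_sym (negbTE ji) mulr0n mul0r.
rewrite !mxE !eqxx !mulr1n.
by case: (a i); rewrite /= ?mul0r ?mul1r ?add0r ?addr0.
Qed.

Variable A : 'M[R]_d.

Lemma selection_Lfun2 a i : (fun w => (A *m selection Z a w) i 0) \in Lfun P 2%:E.
Proof.
have -> : (fun w => (A *m selection Z a w) i 0) = \sum_j (A i j *: Z (a j) j).
  apply/funext => w; rewrite mxE fct_sumE; apply: eq_bigr => j _.
  by rewrite mxE.
have le12 : (1 <= 2%:E :> \bar R)%E by rewrite lee1n.
apply: rpred_sum => j _; apply: rpredZ.
exact: (normal_family_Lfun2 nZ).
Qed.

Lemma Cov_selection a : Cov P (fun w => A *m selection Z a w) = A *m A^T.
Proof.
have L2 := selection_Lfun2 a.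
apply/matrixP => i j; rewrite !mxE covarianceE; last 3 first.
- exact: Lfun2_Lfun1.
- exact: Lfun2_Lfun1.
- exact: Lfun2_mul_Lfun1.
have iZ k : P.-integrable setT (fun w => (Z (a k) k w)%:E).
  exact/Lfun2_integrable/(normal_family_Lfun2 nZ).
have iZZ k l : P.-integrable setT (fun w => (Z (a k) k w * Z (a l) l w)%:E).
  by apply: Lfun2_integrableM; exact: (normal_family_Lfun2 nZ).
have XE k w : (A *m selection Z a w) k 0 = \sum_l A k l * Z (a l) l w.
  by rewrite mxE; apply: eq_bigr => l _; rewrite mxE.
have EX k : ('E_P[fun w => ((A *m selection Z a w) k 0)%R] = 0)%E.
  rewrite expectationE; last exact: Lfun2_integrable.
  under eq_Rintegral do rewrite XE.
  rewrite Rintegral_sum//; last first.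
    move=> l; under eq_fun do rewrite EFinM; exact: integrableZl.
  rewrite big1// => l _; rewrite RintegralZl//; last exact: iZ.
  by rewrite (normal_family_mean nZ) mulr0.
rewrite !EX mule0 sube0 expectationE; last exact: Lfun2_integrableM.
rewrite [fine _]/=.
transitivity (\int[P]_w \sum_k \sum_l
    (A i k * A j l) * (Z (a k) k w * Z (a l) l w)).
  apply: eq_Rintegral => w _; rewrite [LHS]/GRing.mul/= !XE mulr_suml.
  apply: eq_bigr => k _; rewrite mulr_sumr; apply: eq_bigr => l _.
  by rewrite mulrACA.
have iAZ k l : P.-integrable setT
    (fun w => (A i k * A j l * (Z (a k) k w * Z (a l) l w))%:E).
  by under eq_fun do rewrite EFinM; exact: integrableZl.
rewrite Rintegral_sum//; last by move=> k; exact: integrable_sum_EFin.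
apply: eq_bigr => k _; rewrite Rintegral_sum// (bigD1 k)//= big1 ?addr0.
  rewrite RintegralZl//; last exact: iZZ.
  rewrite !mxE -[LHS]mulrA; congr (_ * _).
  rewrite -[RHS]mulr1; congr (_ * _).
  rewrite /Rintegral -[RHS]/(fine 1%:E) -(normal_family_sqr nZ (a k) k).
  by congr fine; apply: eq_integral => w _; rewrite expr2.
move=> l lk; rewrite RintegralZl//; last exact: iZZ.
rewrite (normal_family_uncorrelated nZ) ?mulr0//.
by rewrite xpair_eqE negb_and (eq_sym k) lk orbT.
Qed.

Lemma selection_has_law_N0 a : has_law_N0 P (A *m A^T) (fun w => A *m selection Z a w).
Proof.
split; last exact: Cov_selection.
have -> : (fun w => A *m selection Z a w) =
    (fun w => (A *m selector a) *m selection2 Z xpred0 xpredT w).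
  by apply/funext => w; rewrite selection_selector mulmxA.
exact: centered_gaussian_selection2.
Qed.

(** The images of the two selections are jointly Gaussian with covariance
    [A *m A^T], and their difference is a random multiple of the column [i] of [A],
    whose squared length is [lambda 0 i]. The multiplier is a difference of two
    independent standard normals, hence the factor [2]. *)
Lemma gaussian_lipschitz_selection (kappa : R) (g : 'cV[R]_d -> R) (lambda : 'rV[R]_d)
    a b (i : 'I_d) :
  gaussian_lipschitz kappa (A *m A^T) g ->
  A^T *m A = diag_mx lambda ->
  (forall j, (a j == b j) = (j != i)) ->
  (\int[P]_w ((g (A *m selection Z a w) - g (A *m selection Z b w)) ^+ 2)%:E <=
   (kappa ^+ 2 * (2 * lambda 0 i))%:E)%E.
Proof.
move=> lip AA ab.
have gauss : centered_gaussian P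
    (fun w => col_mx (A *m selection Z a w) (A *m selection Z b w)).
  have -> : (fun w => col_mx (A *m selection Z a w) (A *m selection Z b w)) =
      (fun w => col_mx (A *m selector a) (A *m selector b) *m
        selection2 Z xpred0 xpredT w).
    by apply/funext => w; rewrite mul_col_mx !selection_selector !mulmxA.
  exact: centered_gaussian_selection2.
have loew c : loewner_le (Cov P (fun w => A *m selection Z c w)) (A *m A^T).
  rewrite Cov_selection /loewner_le subrr; split; first by rewrite trmx0.
  by move=> x; rewrite mulmx0 mul0mx mxE.
have := lip _ _ P _ _ gauss (loew a) (loew b).
rewrite unlock => /le_trans; apply.
have normE w : euclidean_norm (A *m selection Z a w - A *m selection Z b w) ^+ 2 =
    lambda 0 i * (Z (a i) i w - Z (b i) i w) ^+ 2.
  rewrite sqr_sqrtr; last by apply: sumr_ge0 => k _; exact: sqr_ge0.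
  rewrite -mulmxBr; set v := selection Z a w - selection Z b w.
  transitivity ((v^T *m (A^T *m A) *m v) 0 0).
    rewrite !mulmxA -trmx_mul -mulmxA mxE; apply: eq_bigr => k _.
    by rewrite [X in _ = X * _]mxE expr2.
  rewrite AA mxE (bigD1 i)//= big1 ?addr0 => [|j ji].
    by rewrite mul_mx_diag /v !mxE; ring.
  by rewrite mul_mx_diag /v !mxE (eqP (etrans (ab j) ji)) subrr mulr0.
under eq_integral do rewrite normE.
have iZ s : Z s i \in Lfun P 2%:E by exact: (normal_family_Lfun2 nZ).
have iD : P.-integrable setT (fun w => ((Z (a i) i w - Z (b i) i w) ^+ 2)%:E).
  under eq_fun do rewrite expr2.
  apply: (Lfun2_integrableM (X := Z (a i) i - Z (b i) i)
    (Y := Z (a i) i - Z (b i) i));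
    by have le12 : (1 <= 2%:E :> \bar R)%E; [rewrite lee1n|exact: rpredB].
under eq_integral do rewrite EFinM.
rewrite integralZl//.
have -> : (\int[P]_w ((Z (a i) i w - Z (b i) i w) ^+ 2)%:E = 2%:E)%E.
  have iM s t : P.-integrable setT (fun w => (Z s i w * Z t i w)%:E).
    exact: Lfun2_integrableM.
  have sqrE s : \int[P]_w (Z s i w * Z s i w) = 1.
    rewrite /Rintegral -[RHS]/(fine 1%:E) -(normal_family_sqr nZ s i).
    by congr fine; apply: eq_integral => w _; rewrite expr2.
  rewrite -[LHS]fineK ?integrable_fin_num// -/(Rintegral _ _ _).
  congr (_%:E).
  transitivity (\int[P]_w ((Z (a i) i w * Z (a i) i w +
      Z (b i) i w * Z (b i) i w) - 2 * (Z (a i) i w * Z (b i) i w))).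
    by apply: eq_Rintegral => w _; ring.
  have iMD : P.-integrable setT (fun w =>
      (Z (a i) i w * Z (a i) i w + Z (b i) i w * Z (b i) i w)%:E).
    by under eq_fun do rewrite EFinD; exact: integrableD.
  have iMZ : P.-integrable setT (fun w => (2 * (Z (a i) i w * Z (b i) i w))%:E).
    by under eq_fun do rewrite EFinM; exact: integrableZl.
  rewrite RintegralB//.
  rewrite RintegralD; [|by []|exact: iM|exact: iM].
  rewrite RintegralZl//; last exact: iM.
  rewrite !sqrE.
  rewrite (normal_family_uncorrelated nZ) ?mulr0 ?subr0//.
  by rewrite xpair_eqE eqxx andbT ab eqxx.
by rewrite -!EFinM lee_fin [2 * _]mulrC.
Qed.

End GaussianSelections.

(** * Correlations of a function at two overlapping vectors *)

Section Correlations.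
Context {R : realType} {d : nat} {disp : measure_display}.
Context {Omega : measurableType disp} {P : probability Omega R}.
Context {U : 'I_d -> Omega -> R}.
Hypothesis nU : normal_family P setT (fun _ : unit => U).
Variable f : 'cV[R]_d -> R.
Hypothesis mf : measurable_fun [set: borel_vec d] (f : borel_vec d -> R).
Local Notation P2 := (P \x P)%E.
Local Notation V := (selection (two_copies (U := U))).
Hypothesis fL2 : (fun w => f (V xpred0 w)) \in Lfun P2 2%:E.

Let nV := normal_family_two_copies nU.

(** The correlation of [f] at two selections; it depends only on the set of
    coordinates that they share. *)
Definition pair_moment (a b : 'I_d -> bool) : R :=
  \int[P2]_w (f (V a w) * f (V b w)).

Let h (x : borel_vec (R := R) (d + d)) : R := f (usubmx x) * f (dsubmx x).

Let mh : measurable_fun [set: borel_vec (d + d)] h.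
Proof.
apply: measurable_funM; apply: (measurableT_comp mf); apply: measurable_vec => i.
  rewrite [X in measurable_fun _ X](_ : _ = fun x : 'cV_(d + d) => x (lshift d i) 0).
    exact: measurable_coord.
  by apply/funext => x; rewrite mxE.
rewrite [X in measurable_fun _ X](_ : _ = fun x : 'cV_(d + d) => x (rshift d i) 0).
  exact: measurable_coord.
by apply/funext => x; rewrite mxE.
Qed.

Let hE {Om : Type} {S : finType} (Z : S -> 'I_d -> Om -> R) a b w :
  h (selection2 Z a b w) = f (selection Z a w) * f (selection Z b w).
Proof. by rewrite /h /selection2 col_mxKu col_mxKd. Qed.

Section Transfer.
Context {disp' : measure_display} {Om : measurableType disp'}.
Context {Q : probability Om R} {E : set Om} {S : finType}.
Context {Z : S -> 'I_d -> Om -> R} (nZ : normal_family Q E Z).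

Lemma measurable_fun_selection a :
  measurable_fun [set: Om] (fun w => f (selection Z a w)).
Proof. exact: (measurableT_comp mf (measurable_selection nZ a)). Qed.

Lemma ge0_integral_sqr_selection a :
  (\int[Q]_(w in E) (f (selection Z a w) ^+ 2)%:E < +oo)%E.
Proof.
have hh : measurable_fun [set: borel_vec (d + d)]
    (fun x : borel_vec (d + d) => `|h x|%:E).
  by apply/measurable_EFinP; exact: measurableT_comp.
have := @ge0_integral_selection2 R d _ _ _ _ Q P2 E _ _ Z _ a a xpred0 xpred0 _ nZ nV
  _ hh _.
under eq_integral do rewrite hE -expr2 ger0_norm ?sqr_ge0//.
move=> ->//; last by move=> i; rewrite !eqxx.
have mE : measurable E by case: nZ.
rewrite lte_mul_pinfty ?fin_num_measure//.
under eq_integral do rewrite hE -expr2 ger0_norm ?sqr_ge0//.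
have /integrableP[_] := Lfun2_integrable_sqr fL2.
by under eq_integral do rewrite /= ger0_norm ?sqr_ge0//.
Qed.

End Transfer.

Lemma two_copies_Lfun2 a : (fun w => f (V a w)) \in Lfun P2 2%:E.
Proof.
apply: Lfun2P; first exact: measurable_fun_selection nV a.
exact: ge0_integral_sqr_selection nV a.
Qed.

Section Transfer2.
Context {disp' : measure_display} {Om : measurableType disp'}.
Context {Q : probability Om R} {E : set Om} {S : finType}.
Context {Z : S -> 'I_d -> Om -> R} (nZ : normal_family Q E Z).

Lemma integrable_mul_selection a b :
  Q.-integrable E (fun w => (f (selection Z a w) * f (selection Z b w))%:E).
Proof.
have := @integrable_selection2 R d _ _ _ _ Q P2 E _ _ Z _ a b xpred0
  (fun i => a i != b i) _ nZ nV _ mh.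
under [in X in _ -> _ -> X]eq_fun do rewrite hE.
apply; first by move=> i; case: (a i == b i).
under eq_fun do rewrite hE.
exact: Lfun2_integrableM (two_copies_Lfun2 _) (two_copies_Lfun2 _).
Qed.

Lemma Rintegral_mul_selection a b a' b' : (forall i, (a i == b i) = (a' i == b' i)) ->
  \int[Q]_(w in E) (f (selection Z a w) * f (selection Z b w)) =
  fine (Q E) * pair_moment a' b'.
Proof.
move=> ab; rewrite /pair_moment.
have := @Rintegral_selection2 R d _ _ _ _ Q P2 E _ _ Z _ a b a' b' _ nZ nV ab mh.
under eq_Rintegral do rewrite hE.
under [in X in _ = _ * X]eq_Rintegral do rewrite hE.
apply; under eq_fun do rewrite hE.
exact: Lfun2_integrableM (two_copies_Lfun2 _) (two_copies_Lfun2 _).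
Qed.

Lemma Rintegral_selection a :
  \int[Q]_(w in E) f (selection Z a w) = fine (Q E) * \int[P2]_w f (V xpred0 w).
Proof.
pose h1 (x : borel_vec (R := R) (d + d)) : R := f (usubmx x).
have mh1 : measurable_fun [set: borel_vec (d + d)] h1.
  apply: (measurableT_comp mf); apply: measurable_vec => i.
  rewrite [X in measurable_fun _ X](_ : _ = fun x : 'cV_(d + d) => x (lshift d i) 0).
    exact: measurable_coord.
  by apply/funext => x; rewrite mxE.
have h1E (Om' : Type) (S' : finType) (Z' : S' -> 'I_d -> Om' -> R) c w :
    h1 (selection2 Z' c c w) = f (selection Z' c w) by rewrite /h1 /selection2 col_mxKu.
have := @Rintegral_selection2 R d _ _ _ _ Q P2 E _ _ Z _ a a xpred0 xpred0 _ nZ nV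
  _ mh1.
under eq_Rintegral do rewrite h1E.
under [in X in _ = _ * X]eq_Rintegral do rewrite h1E.
apply=> [i|]; first by rewrite !eqxx.
under eq_fun do rewrite h1E.
exact: Lfun2_integrable (two_copies_Lfun2 _).
Qed.

End Transfer2.

Lemma eq_pair_moment a b a' b' : (forall i, (a i == b i) = (a' i == b' i)) ->
  pair_moment a b = pair_moment a' b'.
Proof.
move=> ab; rewrite {1}/pair_moment (Rintegral_mul_selection nV ab).
by rewrite probability_setT mul1r.
Qed.

(** The correlation that survives the renewal of the first [t] coordinates. *)
Definition overlap (t : nat) : R := pair_moment xpred0 (fun i => (i < t)%N).

(** The part of the variance of [f] attached to the coordinate [i]: by
    [overlap_telescope] and [overlap_full] the gaps add up to that variance. *)
Definition gap (i : nat) : R := overlap i - overlap i.+1.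

Lemma overlap_telescope (t : nat) : (t <= d)%N ->
  overlap t = overlap d + \sum_(i < d | (t <= i)%N) gap i.
Proof.
move=> td; rewrite -(big_mkord (fun i => (t <= i)%N) gap).
rewrite (big_cat_nat (n := t))//= big1_seq ?add0r => [|i]; last first.
  by rewrite mem_index_iota => /andP[ti /andP[_ it]]; rewrite leqNgt it in ti.
rewrite big_nat_cond (eq_bigl (fun i => (t <= i < d)%N)) => [|i]; last first.
  by case: (t <= i)%N; rewrite ?andbT.
rewrite -big_nat; under eq_bigr do rewrite /gap -opprB.
by rewrite sumrN telescope_sumr// opprB addrC subrK.
Qed.

(** Let the pairs [a1], [a2] and [a3], [a4] each differ in the coordinate [i] alone,
    while the first two and the last two have independent coordinates before [i] and
    common coordinates after [i]. Expanding the product of the increments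
    [f a1 - f a2] and [f a3 - f a4] gives twice the gap in expectation, and the
    product is at most the mean of the squares of the increments. *)
Lemma gap_le (i : 'I_d) (c : R) :
  (forall a b, (forall j, (a j == b j) = (j != i)) ->
    (\int[P2]_w ((f (V a w) - f (V b w)) ^+ 2)%:E <= c%:E)%E) ->
  gap i <= c / 2.
Proof.
move=> fc.
(* [true] stands for the second copy: it supplies the coordinate [i] in [a2] and
   [a4], and the coordinates before [i] in [a3] and [a4]. *)
pose a1 : 'I_d -> bool := xpred0.
pose a2 (j : 'I_d) := j == i.
pose a3 (j : 'I_d) := (j < i)%N.
pose a4 (j : 'I_d) := (j < i.+1)%N.
have L2 := two_copies_Lfun2.
have le12 : (1 <= 2%:E :> \bar R)%E by rewrite lee1n.
have L2B a b : (fun w => f (V a w) - f (V b w)) \in Lfun P2 2%:E.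
  by apply: (@rpredB _ _ (fun w => f (V a w)) (fun w => f (V b w))).
have iM a b := Lfun2_integrableM (L2 a) (L2 b).
have isq a b : P2.-integrable setT
    (fun w => ((f (V a w) - f (V b w)) ^+ 2)%:E).
  exact: Lfun2_integrable_sqr.
have fcR a b : (forall j, (a j == b j) = (j != i)) ->
    \int[P2]_w ((f (V a w) - f (V b w)) ^+ 2) <= c.
  by move=> /fc; rewrite -lee_fin /Rintegral fineK// integrable_fin_num.
have K23 : pair_moment a2 a3 = overlap i.+1.
  apply: eq_pair_moment => j; rewrite /a2 /a3 -val_eqE/= ltnS.
  by case: ltngtP.
have K24 : pair_moment a2 a4 = overlap i.
  apply: eq_pair_moment => j; rewrite /a2 /a4 -val_eqE/= ltnS.
  by case: ltngtP.
have E2 : \int[P2]_w ((f (V a1 w) - f (V a2 w)) * (f (V a3 w) - f (V a4 w))) =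
    2 * gap i.
  transitivity (\int[P2]_w ((f (V a1 w) * f (V a3 w) - f (V a1 w) * f (V a4 w)) -
      (f (V a2 w) * f (V a3 w) - f (V a2 w) * f (V a4 w)))).
    by apply: eq_Rintegral => w _; ring.
  have iB a b c' e : P2.-integrable setT
      (fun w => (f (V a w) * f (V b w) - f (V c' w) * f (V e w))%:E).
    by under eq_fun do rewrite EFinB; apply: integrableB.
  rewrite RintegralB; [|by []|exact: iB|exact: iB].
  rewrite RintegralB; [|by []|exact: iM|exact: iM].
  rewrite RintegralB; [|by []|exact: iM|exact: iM].
  rewrite -!/(pair_moment _ _) K23 K24 /gap /overlap -/a3 -/a4 -/a1; ring.
have c1 : \int[P2]_w ((f (V a1 w) - f (V a2 w)) ^+ 2) <= c.
  by apply: fcR => j; rewrite /a1 /a2; case: (j == i).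
have c2 : \int[P2]_w ((f (V a3 w) - f (V a4 w)) ^+ 2) <= c.
  by apply: fcR => j; rewrite /a3 /a4 -val_eqE ltnS; case: ltngtP.
have : 2 * gap i <= 2^-1 * (c + c).
  have iD : P2.-integrable setT (fun w => ((f (V a1 w) - f (V a2 w)) ^+ 2 +
      (f (V a3 w) - f (V a4 w)) ^+ 2)%:E).
    by under eq_fun do rewrite EFinD; exact: integrableD.
  have iS : P2.-integrable setT (fun w => (2^-1 * ((f (V a1 w) - f (V a2 w)) ^+ 2 +
      (f (V a3 w) - f (V a4 w)) ^+ 2))%:E).
    by under eq_fun do rewrite EFinM; exact: integrableZl.
  rewrite -E2; apply: (@le_trans _ _ (\int[P2]_w (2^-1 *
      ((f (V a1 w) - f (V a2 w)) ^+ 2 + (f (V a3 w) - f (V a4 w)) ^+ 2)))).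
    apply: le_Rintegral => //; first exact: Lfun2_integrableM.
    move=> w _; set x := _ - _; set y := _ - _.
    by have := sqr_ge0 (x - y); lra.
  rewrite RintegralZl//.
  rewrite RintegralD; [|by []|exact: isq|exact: isq].
  by rewrite ler_wpM2l// lerD.
lra.
Qed.

(** Without shared coordinates the two vectors are independent. *)
Lemma overlap_full : overlap d = (\int[P2]_w f (V xpred0 w)) ^+ 2.
Proof.
pose pU := selection (fun _ : unit => U) (fun=> tt).
pose fU w := f (pU w).
have V0 w : V xpred0 w = pU w.1 by apply/colP => i; rewrite !mxE.
have V1 w : V xpredT w = pU w.2 by apply/colP => i; rewrite !mxE.
have iU : P.-integrable setT (fun w => (fU w)%:E).
  apply: Lfun2_integrable; apply: Lfun2P; first exact: measurable_fun_selection nU _.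
  exact: (ge0_integral_sqr_selection nU).
have -> : overlap d = \int[P2]_w (fU w.1 * fU w.2).
  rewrite /overlap (@eq_pair_moment _ _ xpred0 xpredT) => [|i].
    by apply: eq_Rintegral => w _; rewrite V0 V1.
  by rewrite ltn_ord.
have EU : \int[P2]_w f (V xpred0 w) = \int[P]_w fU w.
  have := Rintegral_selection nU (fun=> tt).
  by rewrite probability_setT mul1r.
rewrite EU /Rintegral -integral12_prod_meas1; last first.
  have := Lfun2_integrableM (two_copies_Lfun2 xpred0) (two_copies_Lfun2 xpredT).
  by under eq_fun do rewrite V0 V1.
rewrite /fubini_F.
rewrite [X in fine X = _](eq_integral
  (fun x => (fU x)%:E * \int[P]_y (fU y)%:E)%E); last first.
  by move=> x _; rewrite -integralZl//; apply: eq_integral => y _.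
have mE : (\int[P]_y (fU y)%:E = (\int[P]_y fU y)%:E)%E.
  by rewrite fineK// integrable_fin_num.
by rewrite mE integralZr// mE -EFinM expr2.
Qed.


End Correlations.

(** * The chain of renewed vectors *)

Section RefreshChain.
Context {R : realType} {d : nat}.
Implicit Types (N : nat -> nat) (G : nat -> 'cV[R]_d) (nu : nat -> nat).

Fixpoint refresh_chain (u : 'cV[R]_d) N G (k : nat) : 'cV[R]_d :=
  if k is k'.+1 then
    \col_(i < d) (if (i < N k')%N then G k' i 0 else refresh_chain u N G k' i 0)
  else u.

Lemma GRDR_loop_U ct (g : 'cV[R]_d -> R) (A : 'M[R]_d) u N G k :
  st_U (GRDR_loop ct g A N G k (GRDR_init ct g A u)) = refresh_chain u N G k.
Proof. by elim: k => //= k ->. Qed.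

Lemma GRDR_loop_X ct (g : 'cV[R]_d -> R) (A : 'M[R]_d) u N G k :
  st_X (GRDR_loop ct g A N G k (GRDR_init ct g A u)) =
  A *m refresh_chain u N G k.
Proof.
elim: k => //= k IH; rewrite IH GRDR_loop_U mulmxBr addrC subrK.
by [].
Qed.

Lemma GRDR_loop_S ct (g : 'cV[R]_d -> R) (A : 'M[R]_d) u N G k :
  st_S (GRDR_loop ct g A N G k (GRDR_init ct g A u)) =
  \sum_(j < k.+1) g (A *m refresh_chain u N G j).
Proof.
elim: k => [|k IH]; first by rewrite big_ord1.
rewrite big_ord_recr /= -IH; congr (_ + g _).
exact: GRDR_loop_X k.+1.
Qed.

(** The default [inl tt] is never reached: [source] is only read at [k <= m]. *)
Definition iteration_source (m k : nat) : unit + 'I_m :=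
  if insub k is Some l then inr l else inl tt.

(** The draw that the coordinate [i] shows after [k] iterations: the initial one
    or the last iteration that renewed it. *)
Fixpoint source (m : nat) nu (k i : nat) : unit + 'I_m :=
  if k is k'.+1 then
    if (i < nu k')%N then iteration_source m k' else source m nu k' i
  else inl tt.

Lemma source_lt m nu k i l : source m nu k i = inr l -> (l < k)%N.
Proof.
elim: k => //= k IH; case: ifP => _; last by move=> /IH /leqW.
rewrite /iteration_source; case: insubP => // l' _ l'k [<-].
by rewrite l'k.
Qed.

(** An iteration whose integer exceeds [i] becomes the source of the coordinate [i],
    and it is later than any source that could have been in force at time [j]. *)
Lemma source_agree m nu j k i : (j <= k <= m)%N ->
  (source m nu j i == source m nu k i) = (\max_(j <= l < k) nu l <= i)%N.
Proof.
move=> /andP[jk]; elim: k jk => [|k IH] jk km.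
  by move: jk; rewrite leqn0 => /eqP ->; rewrite big_geq// eqxx.
move: jk; rewrite leq_eqVlt => /predU1P[->|jk]; first by rewrite big_geq// eqxx.
rewrite big_nat_recr//= geq_max; case: (ltnP i (nu k)) => ik; last first.
  by rewrite andbT IH// ltnW.
rewrite andbF; apply/negbTE/eqP.
rewrite /iteration_source insubT => /source_lt/=.
by rewrite ltnNge -ltnS jk.
Qed.

Definition draw_family {Omega : Type} {m : nat} (U : 'I_d -> Omega -> R)
    (G : nat -> 'I_d -> Omega -> R) (s : unit + 'I_m) (i : 'I_d) : Omega -> R :=
  if s is inr l then G l i else U i.

Lemma refresh_chain_source {Omega : Type} {m : nat} (U : 'I_d -> Omega -> R)
    (N : nat -> Omega -> nat) (G : nat -> 'I_d -> Omega -> R) nu (k : nat) w :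
  (k <= m)%N -> (forall l, (l < k)%N -> N l w = nu l) ->
  refresh_chain (\col_i U i w) (fun l => N l w) (fun l => \col_i G l i w) k =
  selection (draw_family (m := m) U G) (source m nu k) w.
Proof.
elim: k => [|k IH] km Nnu; first by apply/colP => i; rewrite !mxE.
apply/colP => i; rewrite /= IH; last 2 first.
- exact: ltnW.
- by move=> l lk; apply: Nnu; exact: ltnW.
rewrite !mxE Nnu//=; case: ifP => // _.
by rewrite /iteration_source insubT.
Qed.

End RefreshChain.

Lemma measurable_nat_fun {disp disp'} {T : measurableType disp}
    {T' : measurableType disp'} (X : T -> nat) (h : nat -> T') :
  measurable_fun [set: T] X -> measurable_fun [set: T] (h \o X).
Proof. by move=> mX; apply: measurableT_comp. Qed.

Section RandomChain.
Context {R : realType} {d : nat} {q : 'I_d -> R}.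
Context {disp : measure_display} {Omega : measurableType disp}.
Context {P : probability Omega R}.
Context {U : 'I_d -> {RV P >-> R}} {N : nat -> {RV P >-> nat}}.
Context {G : nat -> 'I_d -> {RV P >-> R}}.
Hypothesis draws : GRDR_randomness q U N G.
Local Notation m := (GRDR_n q).-1.
Local Notation Z := (draw_family (m := m) (fun i => U i : Omega -> R)
  (fun k i => G k i : Omega -> R)).
Local Notation gamma := (normal_prob (0 : R) 1).

Definition random_chain (k : nat) (w : Omega) : 'cV[R]_d :=
  refresh_chain (\col_i U i w) (fun l => N l w) (fun l => \col_i G l i w) k.

(** Regrouping the factors of the independence hypothesis, integers first, then
    normal variables by coordinate, gives the shape required by [normal_family]. *)
Lemma draws_box (C : 'I_m -> set R) (B : unit + 'I_m -> 'I_d -> set R) :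
  (forall k, measurable (C k)) -> (forall s i, measurable (B s i)) ->
  P ([set w | forall k : 'I_m, C k (N k w)%:R] `&`
     [set w | forall s i, B s i (Z s i w)]) =
  (\prod_(k < m) P [set w | C k (N k w)%:R] *
   \prod_(i < d) \prod_(s : unit + 'I_m) gamma (B s i))%E.
Proof.
move=> mC mB; case: draws => dU _ _ dG dI.
pose D (j : 'I_d + ('I_m + 'I_m * 'I_d)) : set R :=
  match j with
  | inl i => B (inl tt) i
  | inr (inl k) => C k
  | inr (inr (k, i)) => B (inr k) i
  end.
have mD j : measurable (D j) by case: j => [i|[k|[k i]]]; rewrite /D.
have -> : [set w | forall k : 'I_m, C k (N k w)%:R] `&`
     [set w | forall s i, B s i (Z s i w)] =
   \bigcap_(j in [set: 'I_d + ('I_m + 'I_m * 'I_d)])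
     (GRDR_draws U N G j @^-1` D j).
  apply/seteqP; split=> w /=.
    move=> [h1 h2] [i|[k|[k i]]] _ /=; [exact: (h2 (inl tt))|exact: h1|].
    exact: (h2 (inr k)).
  move=> h; split=> [k|[[]|k] i].
  - exact: (h (inr (inl k))).
  - exact: (h (inl i)).
  - exact: (h (inr (inr (k, i)))).
rewrite dI// !big_sumType/= muleCA; congr (_ * _)%E.
under [RHS]eq_bigr do rewrite big_sumType/=.
rewrite big_split/=; congr (_ * _)%E.
  apply: eq_bigr => i _; rewrite (big_pred1 tt); last by case.
  exact: dU.
rewrite [RHS]exchange_big pair_bigA/=; apply: eq_bigr => -[k i] _ /=.
exact: dG.
Qed.

Definition path_event (nu : nat -> nat) : set Omega :=
  [set w | forall k : 'I_m, N k w = nu k].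

Lemma measurable_N_set (C : nat -> set nat) :
  measurable [set w | forall k : 'I_m, C k (N k w)].
Proof.
have -> : [set w | forall k : 'I_m, C k (N k w)] =
    \bigcap_(k in [set: 'I_m]) (N k @^-1` C k).
  by apply/seteqP; split=> w /= h k; [move=> _; exact: h|exact: (h k I)].
apply: fin_bigcap_measurable => [|k _]; first exact: finite_finset.
by rewrite -[X in measurable X]setTI; apply: measurable_funP.
Qed.

(** The integers are independent of the normal variables, so these remain
    independent and normal given the integers. *)
Lemma normal_family_path nu : normal_family P (path_event nu) Z.
Proof.
split.
- exact: (measurable_N_set (fun k => [set n | n = nu k])).
- by move=> [[]|k] i; apply: measurable_funP.
- move=> B mB.
  pose C (k : 'I_m) := [set (nu k)%:R : R].
  have EC : path_event nu = [set w | forall k : 'I_m, C k (N k w)%:R].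
    apply/seteqP; split=> w /= h k; first by rewrite h.
    by apply/eqP; rewrite -(eqr_nat R); apply/eqP; exact: h.
  have mC k : measurable (C k) by exact: measurable_set1.
  rewrite EC draws_box//; congr (_ * _)%E.
  have := @draws_box C (fun _ _ => setT) mC (fun _ _ => measurableT).
  rewrite (_ : [set w | forall s i, setT _] = setT) ?setIT; last first.
    by apply/seteqP; split.
  move=> ->; rewrite [X in (_ * X)%E]big1 ?mule1// => i _.
  by rewrite big1// => s _; exact: probability_setT.
Qed.

Lemma normal_family_init :
  normal_family P setT (fun _ : unit => U : 'I_d -> Omega -> R).
Proof.
split=> // B mB.
have := @draws_box (fun=> setT) (fun s => if s is inl _ then B tt else fun=> setT)
  (fun=> measurableT).
rewrite (_ : [set w | forall k : 'I_m, setT _] = setT); last first.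
  by apply/seteqP; split.
rewrite (_ : [set w | forall s i, _ (Z s i w)] =
    [set w | forall (_ : unit) i, B tt i (U i w)]); last first.
  apply/seteqP; split=> w /= h; first by move=> _ i; exact: (h (inl tt)).
  by move=> [[]|k] i //; exact: (h tt).
rewrite (_ : [set w | forall s i, _] =
    [set w | forall (_ : unit) i, B tt i (U i w)]); last first.
  by apply/seteqP; split=> w /= h [] i; exact: (h tt).
move=> ->; last by case.
rewrite [X in (X * _)%E]big1 => [|k _]; last first.
  exact: probability_setT.
rewrite probability_setT; congr (_ * _)%E; apply: eq_bigr => i _.
rewrite big_sumType/= [X in (_ * X)%E]big1 ?mule1; last first.
  by move=> k _; exact: probability_setT.
by apply: eq_bigr => -[].
Qed.

(** The coordinate [i] survives each iteration with probability [1 - q i]. *)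
Lemma probability_max_le (j k : nat) (i : 'I_d) : (j <= k <= m)%N ->
  P [set w | (\max_(j <= l < k) N l w <= i)%N] = ((1 - q i) ^+ (k - j))%:E.
Proof.
move=> /andP[jk km]; case: draws => _ _ dN _ _.
pose C (l : 'I_m) : set R := if (j <= l < k)%N then [set x | x <= i%:R] else setT.
have mC l : measurable (C l).
  rewrite /C; case: ifP => // _.
  have -> : [set x : R | x <= i%:R] = `]-oo, i%:R]%classic.
    by apply/seteqP; split=> x; rewrite /= in_itv.
  exact: measurable_itv.
have -> : [set w | (\max_(j <= l < k) N l w <= i)%N] =
    [set w | forall l : 'I_m, C l (N l w)%:R].
  apply/seteqP; split=> w /=.
    move=> /bigmax_leqP_seq h l; rewrite /C; case: ifP => //= jlk.
    rewrite ler_nat; apply: h => //; rewrite mem_index_iota//.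
  move=> h; apply/bigmax_leqP_seq => l; rewrite mem_index_iota => jlk _.
  have lm : (l < m)%N by case/andP: jlk => _ lk; exact: leq_trans km.
  have := h (Ordinal lm); rewrite /C /= jlk /= ler_nat.
  exact.
have := @draws_box C (fun _ _ => setT) mC (fun _ _ => measurableT).
rewrite (_ : [set w | forall s i, setT _] = setT) ?setIT; last first.
  by apply/seteqP; split.
move=> ->; rewrite [X in (_ * X)%E]big1 ?mule1 => [|i' _]; last first.
  by rewrite big1// => s _; exact: probability_setT.
transitivity (\prod_(l < m) (if (j <= l < k)%N then (1 - q i)%:E else 1))%E.
  apply: eq_bigr => l _; rewrite /C; case: ifP => _; last first.
    exact: probability_setT.
  have -> : [set w | [set x : R | x <= i%:R] (N l w)%:R] = ~` [set w | (i < N l w)%N].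
    by apply/funext => w /=; rewrite ler_nat leqNgt; apply/propext; split => /negP.
  rewrite probability_setC ?dN//.
  have mN : measurable_fun [set: Omega] (N l) by apply: measurable_funP.
  by rewrite -[X in measurable X]setTI; exact: (mN _ [set n | (i < n)%N]).
rewrite -(big_mkord xpredT (fun l => if (j <= l < k)%N then (1 - q i)%:E else 1%E)).
rewrite -big_mkcond/= (big_cat_nat (n := k))//= [X in (_ * X)%E]big1_seq; last first.
  move=> l; rewrite mem_index_iota => /andP[/andP[_ lk] /andP[kl _]].
  by rewrite ltnNge kl in lk.
rewrite mule1 (big_cat_nat (n := j))//= [X in (X * _)%E]big1_seq; last first.
  move=> l; rewrite mem_index_iota => /andP[/andP[jl _] /andP[_ lj]].
  by rewrite ltnNge jl in lj.
rewrite mul1e big_nat_cond (eq_bigl (fun l => (j <= l < k)%N)); last first.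
  by move=> l; rewrite andbb.
rewrite -big_nat big_const_nat.
by elim: (k - j)%N => //= n ->; rewrite exprS EFinM.
Qed.

End RandomChain.

(** * Variance of the average along the chain *)

Lemma sum_geometric_le {R : realFieldType} (p : R) (n : nat) : 0 < p <= 1 ->
  \sum_(0 <= k < n) (1 - p) ^+ k <= p^-1.
Proof.
move=> /andP[p0 p1]; rewrite -(ler_pM2l p0) mulfV ?gt_eqF//.
have := subrX1 (1 - p) n; rewrite -(big_mkord xpredT (fun i => (1 - p) ^+ i)).
have -> : 1 - p - 1 = - p by ring.
have : 0 <= (1 - p) ^+ n by rewrite exprn_ge0// subr_ge0.
lra.
Qed.

(** Each row of the sum is bounded by two geometric series, one on either side of the
    diagonal. *)
Lemma sum_geometric_dist_le {R : realFieldType} (p : R) (n : nat) : 0 < p <= 1 ->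
  \sum_(j < n) \sum_(k < n) (1 - p) ^+ (j - k + (k - j)) <= n%:R * (2 / p).
Proof.
move=> p01; have /andP[p0 p1] := p01.
have r0 : 0 <= 1 - p by rewrite subr_ge0.
rewrite -[n in n%:R]card_ord -sum1_card natr_sum mulr_suml.
apply: ler_sum => j _; rewrite mul1r.
rewrite -(big_mkord xpredT (fun k => (1 - p) ^+ (j - k + (k - j)))).
rewrite (big_cat_nat (n := j))//=; last exact: ltnW.
have -> : 2 / p = p^-1 + p^-1 by ring.
apply: lerD.
  apply: le_trans (sum_geometric_le j p01).
  rewrite big_nat_rev big_nat [leRHS]big_nat; apply: ler_sum => k /andP[_ kj].
  rewrite add0n.
  have -> : (j - (j - k.+1) + (j - k.+1 - j))%N = k.+1 by lia.
  by rewrite exprS ler_piMl ?exprn_ge0// gerBl ltW.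
apply: le_trans (sum_geometric_le (n - j) p01).
rewrite -{1}[nat_of_ord j]add0n big_addn le_eqVlt; apply/orP; left; apply/eqP.
apply: eq_bigr => k _; congr (_ ^+ _); lia.
Qed.

Lemma Rintegral_partition {R : realType} {disp} {Omega : measurableType disp}
    (P : probability Omega R) {I : finType} (E : I -> set Omega) (F : Omega -> R) :
  (forall i, measurable (E i)) -> (forall w, exists i, E i w) ->
  (forall i j w, E i w -> E j w -> i = j) -> measurable_fun [set: Omega] F ->
  (forall i, P.-integrable (E i) (fun w => (F w)%:E)) ->
  P.-integrable setT (fun w => (F w)%:E) /\
  \int[P]_w F w = \sum_i \int[P]_(w in E i) F w.
Proof.
move=> mE cE dE mF iF.
have tE : trivIset [set` index_enum I] E.
  by move=> i j _ _ [w [iw jw]]; exact: dE iw jw.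
have UE : \big[setU/set0]_(i <- index_enum I) E i = [set: Omega].
  apply/seteqP; split=> // w _; have [i Ei] := cE w.
  by rewrite -bigcup_seq; exists i => //=; exact: mem_index_enum.
have split_int (H : Omega -> R) : measurable_fun [set: Omega] H ->
    (\int[P]_w (H w)%:E = \sum_i \int[P]_(w in E i) (H w)%:E)%E.
  move=> mH; rewrite -UE integral_bigsetU_EFin// ?index_enum_uniq//.
  by rewrite UE; exact/measurable_EFinP.
have iT : P.-integrable setT (fun w => (F w)%:E).
  apply/integrableP; split; first exact/measurable_EFinP.
  rewrite (split_int (fun w => `|F w|)); last exact: measurableT_comp.
  apply: lte_sum_pinfty => i _.
  by have /integrableP[_] := iF i.
split=> //; rewrite /Rintegral split_int// -[RHS]/(fine (EFin _)) -sumEFin.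
congr fine; apply: eq_bigr => i _; rewrite fineK// integrable_fin_num//.
Qed.

Section ChainCorrelations.
Context {R : realType} {d : nat} {q : 'I_d -> R}.
Context {disp : measure_display} {Omega : measurableType disp}.
Context {P : probability Omega R}.
Context {U : 'I_d -> {RV P >-> R}} {N : nat -> {RV P >-> nat}}.
Context {G : nat -> 'I_d -> {RV P >-> R}}.
Hypothesis draws : GRDR_randomness q U N G.
Variable f : 'cV[R]_d -> R.
Hypothesis mf : measurable_fun [set: borel_vec d] (f : borel_vec d -> R).
Local Notation m := (GRDR_n q).-1.
Local Notation P2 := (P \x P)%E.
Local Notation U0 := (fun i => U i : Omega -> R).
Local Notation chain := (random_chain (U := U) (N := N) (G := G)).
Hypothesis fL2 :
  (fun w => f (selection (two_copies (U := U0)) xpred0 w)) \in Lfun P2 2%:E.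
Local Notation nU := (normal_family_init draws).
Local Notation overlap := (overlap (P := P) (U := U0) f).
Local Notation gap := (gap (P := P) (U := U0) f).
Local Notation mean := (\int[P2]_w f (selection (two_copies (U := U0)) xpred0 w)).

Lemma measurable_chain k : measurable_fun [set: Omega] (chain k : Omega -> borel_vec d).
Proof.
elim: k => [|k IH]; apply: measurable_vec => i.
  rewrite [X in measurable_fun _ X](_ : _ = (U i : Omega -> R)).
    exact: measurable_funP.
  by apply/funext => w; rewrite mxE.
rewrite [X in measurable_fun _ X](_ : _ =
    fun w => if (i < N k w)%N then G k i w else chain k w i 0); last first.
  by apply/funext => w; rewrite mxE; case: ifP => //; rewrite mxE.
apply: measurable_fun_ifT.
- have mN : measurable_fun [set: Omega] (N k) by apply: measurable_funP.
  exact: (measurable_nat_fun (fun n => (i < n)%N) mN).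
- exact: measurable_funP.
- exact: (measurableT_comp (measurable_coord i) IH).
Qed.

Let draw_path := {ffun 'I_m -> 'I_d.+1}.

Let nu (p : draw_path) (k : nat) : nat := if insub k is Some l then p l else 0%N.

Let nuE p (l : 'I_m) : nu p l = p l.
Proof. by rewrite /nu valK. Qed.

Let nu_le p k : (nu p k <= d)%N.
Proof. by rewrite /nu; case: insub => // l; rewrite -ltnS. Qed.

Let E (p : draw_path) : set Omega := path_event (N := N) (q := q) (nu p).

Let mE p : measurable (E p).
Proof. by case: (normal_family_path draws (nu p)). Qed.

Let cover_paths w : exists p, E p w.
Proof.
case: draws => _ dN _ _ _.
exists [ffun l : 'I_m => inord (N l w)] => l; rewrite nuE ffunE inordK// ltnS.
by have /andP[] := dN l w.
Qed.

Let disjoint_paths p p' w : E p w -> E p' w -> p = p'.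
Proof.
move=> h h'; apply/ffunP => l; apply/val_inj.
by rewrite /= -!nuE -(h l) -(h' l).
Qed.

Let partition (F : Omega -> R) : measurable_fun [set: Omega] F ->
    (forall p, P.-integrable (E p) (fun w => (F w)%:E)) ->
  P.-integrable setT (fun w => (F w)%:E) /\
  \int[P]_w F w = \sum_p \int[P]_(w in E p) F w.
Proof. exact: (Rintegral_partition mE cover_paths disjoint_paths). Qed.

Let sum_path_probability : \sum_p fine (P (E p)) = 1.
Proof.
have [_] := partition (F := fun=> 1) (measurable_cst _)
  (fun p => finite_measure_integrable_cst P 1 (mE p)).
rewrite Rintegral_cst// mul1r => PE.
transitivity (fine (P setT)); last by rewrite probability_setT.
rewrite PE; apply: eq_bigr => p _.
by rewrite Rintegral_cst// mul1r.
Qed.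

Let chain_selection p k w : (k <= m)%N -> E p w ->
  chain k w = selection (draw_family (m := m) U0 (fun k i => G k i : Omega -> R))
    (source m (nu p) k) w.
Proof.
move=> km Ew.
apply: (@refresh_chain_source R d Omega m U0 (fun l => N l : Omega -> nat)
  (fun k i => G k i : Omega -> R)) => // l lk.
exact: (Ew (Ordinal (leq_trans lk km))).
Qed.

Let Y k w := f (chain k w).

Let mY k : measurable_fun [set: Omega] (Y k).
Proof. exact: (measurableT_comp mf (measurable_chain k)). Qed.

Lemma chain_Lfun2 k : (k <= m)%N -> Y k \in Lfun P 2%:E.
Proof.
move=> km; apply: Lfun2P => //.
have iYp p : P.-integrable (E p) (fun w => (Y k w ^+ 2)%:E).
  have := integrable_mul_selection nU mf fL2 (normal_family_path draws (nu p))
    (source m (nu p) k) (source m (nu p) k).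
  apply: (eq_integrable (mE p)) => w; rewrite inE => Ew.
  by rewrite /Y (chain_selection km Ew) expr2.
have mY2 : measurable_fun [set: Omega] (fun w => Y k w ^+ 2).
  exact: measurable_funX.
have [/integrableP[_] + _] := partition mY2 iYp.
by under eq_integral do rewrite /= ger0_norm ?sqr_ge0//.
Qed.

Lemma chain_mean k : (k <= m)%N -> \int[P]_w Y k w = mean.
Proof.
move=> km.
have YE p : {in E p, Y k =1 fun w => f (selection (draw_family (m := m) U0
    (fun k i => G k i : Omega -> R)) (source m (nu p) k) w)}.
  by move=> w; rewrite inE => Ew; rewrite /Y (chain_selection km Ew).
have iY := Lfun2_integrable (chain_Lfun2 km).
have iYp p : P.-integrable (E p) (fun w => (Y k w)%:E).
  exact: integrableS measurableT (mE p) (@subsetT _ _) iY.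
have [_ ->] := partition (mY k) iYp.
rewrite (eq_bigr (fun p => fine (P (E p)) * mean)) => [|p _].
  by rewrite -mulr_suml sum_path_probability mul1r.
rewrite (eq_Rintegral _ (YE p)).
exact: (Rintegral_selection nU mf fL2 (normal_family_path draws (nu p))).
Qed.

Let max_event j k i : set Omega := [set w | (\max_(j <= l < k) N l w <= i)%N].

Let path_probability (j k i : nat) : (j <= k <= m)%N ->
  fine (P (max_event j k i)) =
  \sum_(p : draw_path) fine (P (E p)) * (\max_(j <= l < k) nu p l <= i)%N%:R.
Proof.
move=> /andP[jk km].
have mH : measurable (max_event j k i).
  have -> : max_event j k i = [set w | forall l : 'I_m,
      [set n | (j <= l < k)%N -> (n <= i)%N] (N l w)].
    apply/seteqP; split=> w /=.
      by move=> /bigmax_leqP_seq h l jlk; apply: h => //; rewrite mem_index_iota.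
    move=> h; apply/bigmax_leqP_seq => l; rewrite mem_index_iota => jlk _.
    have lm : (l < m)%N by case/andP: jlk => _ lk; exact: leq_trans km.
    exact: (h (Ordinal lm)).
  exact: (measurable_N_set (fun l => [set n | (j <= l < k)%N -> (n <= i)%N])).
have i1 : P.-integrable setT (fun w => (\1_(max_event j k i) w)%:E : \bar R).
  apply: (le_integrable _ _ _ (finite_measure_integrable_cst P 1 measurableT)) => //.
  - by apply/measurable_EFinP; exact: measurable_indic.
  - move=> w _; rewrite /= lee_fin normr1 indicE.
    by case: (_ \in _); rewrite ?normr1 ?normr0.
have m1 : measurable_fun [set: Omega] (\1_(max_event j k i) : Omega -> R).
  exact: measurable_indic.
have [_] := partition m1
  (fun p => integrableS measurableT (mE p) (@subsetT _ _) i1).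
rewrite /Rintegral integral_indic// setIT => ->.
apply: eq_bigr => p _; rewrite integral_indic//.
have maxE w : E p w -> \max_(j <= l < k) N l w = \max_(j <= l < k) nu p l.
  move=> Ew; apply: eq_big_nat => l /andP[_ lk].
  exact: (Ew (Ordinal (leq_trans lk km))).
case: (leqP (\max_(j <= l < k) nu p l) i) => h.
  rewrite mulr1; congr (fine (P _)); apply/setIidr => w Ew.
  by rewrite /max_event /= maxE.
rewrite mulr0 (_ : _ `&` _ = set0) ?measure0//.
apply/seteqP; split=> w // -[]; rewrite /max_event /= => + Ew.
by rewrite maxE// leqNgt h.
Qed.

(** Given the integers drawn, the states of times [j] and [k] share the coordinates
    from their maximum on, so the conditional expectation is an [overlap]. Its
    telescoped form makes the average over the integers explicit, since the gap [i]
    contributes exactly when the maximum is at most [i]. *)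
Lemma chain_correlation_le (j k : nat) : (j <= k <= m)%N ->
  \int[P]_w (Y j w * Y k w) =
  mean ^+ 2 + \sum_(i < d) gap i * (1 - q i) ^+ (k - j).
Proof.
move=> jkm; have /andP[jk km] := jkm; have jm := leq_trans jk km.
have YE p : {in E p, (fun w => Y j w * Y k w) =1
    (fun w => f (selection (draw_family (m := m) U0
      (fun k i => G k i : Omega -> R)) (source m (nu p) j) w) *
    f (selection (draw_family (m := m) U0
      (fun k i => G k i : Omega -> R)) (source m (nu p) k) w))}.
  move=> w; rewrite inE => Ew.
  by rewrite /Y (chain_selection km Ew) (chain_selection jm Ew).
have iYY := Lfun2_integrableM (chain_Lfun2 jm) (chain_Lfun2 km).
have [_ ->] := partition (measurable_funM (mY j) (mY k))
  (fun p => integrableS measurableT (mE p) (@subsetT _ _) iYY).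
transitivity (\sum_(p : draw_path) (fine (P (E p)) * mean ^+ 2 +
    \sum_(i < d) gap i *
      (fine (P (E p)) * (\max_(j <= l < k) nu p l <= i)%N%:R))).
  apply: eq_bigr => p _; rewrite (eq_Rintegral _ (YE p)).
  pose t := \max_(j <= l < k) nu p l.
  rewrite (Rintegral_mul_selection nU mf fL2 (normal_family_path draws (nu p))
    (a' := xpred0) (b' := fun i => (i < t)%N)) => [|i]; last first.
    by rewrite source_agree// /t ltnNge; case: (_ <= _)%N.
  rewrite -/(overlap t) overlap_telescope; last first.
    by apply/bigmax_leqP_seq => l _ _; exact: nu_le.
  rewrite (overlap_full nU mf fL2) mulrDr; congr (_ + _).
  rewrite mulr_sumr big_mkcond; apply: eq_bigr => i _; rewrite -/t.
  by case: (t <= i)%N; rewrite ?mulr1 ?mulr0// mulrC.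
rewrite big_split/=; congr (_ + _).
  by rewrite -mulr_suml sum_path_probability mul1r.
rewrite exchange_big; apply: eq_bigr => i _; rewrite -mulr_sumr.
by rewrite -path_probability// (probability_max_le draws).
Qed.

Lemma chain_correlation (j k : nat) : (j <= m)%N -> (k <= m)%N ->
  \int[P]_w (Y j w * Y k w) =
  mean ^+ 2 + \sum_(i < d) gap i * (1 - q i) ^+ (j - k + (k - j)).
Proof.
move=> jm km; case: (leqP j k) => jk.
  rewrite chain_correlation_le ?jk//; congr (_ + _); apply: eq_bigr => i _.
  by rewrite (eqP jk) add0n.
under eq_Rintegral do rewrite mulrC.
rewrite chain_correlation_le ?(ltnW jk)//; congr (_ + _); apply: eq_bigr => i _.
by have /eqP -> := ltnW jk; rewrite addn0.
Qed.

(** Only upper bounds on the gaps are required, because each of them is multiplied by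
    a nonnegative sum of powers of [1 - q i]. *)
Lemma variance_chain_average (c : 'I_d -> R) :
  (0 < GRDR_n q)%N -> (forall i, 0 < q i <= 1) -> (forall i, 0 <= c i) ->
  (forall i : 'I_d, gap i <= c i) ->
  ('V_P[fun w => ((\sum_(k < m.+1) Y k w) / (GRDR_n q)%:R)%R] <=
   (2 / (GRDR_n q)%:R * \sum_(i < d) c i / q i)%R%:E)%E.
Proof.
move=> n0 q01 c0 gapc; rewrite prednK//.
set n := GRDR_n q.
have km (k : 'I_n) : (k <= m)%N by rewrite -ltnS prednK// -/n.
have L2k (k : 'I_n) : Y k \in Lfun P 2%:E by exact: chain_Lfun2.
have nR : (n%:R : R) != 0 by rewrite pnatr_eq0 -lt0n.
have L2 : (fun w => (\sum_(k < n) Y k w) / n%:R) \in Lfun P 2%:E.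
  have le12 : (1 <= 2%:E :> \bar R)%E by rewrite lee1n.
  have -> : (fun w => (\sum_(k < n) Y k w) / n%:R) =
      n%:R^-1 *: \sum_(k < n) Y k.
    by apply/funext => w; rewrite /= fct_sumE mulrC.
  by apply: rpredZ; apply: rpred_sum => k _; exact: L2k.
have iYY (j k : 'I_n) := Lfun2_integrableM (L2k j) (L2k k).
have iY (k : 'I_n) := Lfun2_integrable (L2k k).
have EX : \int[P]_w ((\sum_(k < n) Y k w) / n%:R) = mean.
  rewrite RintegralZr//; last first.
    exact: integrable_sum_EFin.
  rewrite Rintegral_sum// (eq_bigr (fun=> mean)) => [|k _]; last exact: chain_mean.
  by rewrite sumr_const card_ord -[X in X / _]mulr_natr mulfK.
have EX2 : \int[P]_w ((\sum_(k < n) Y k w) / n%:R) ^+ 2 = mean ^+ 2 +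
    n%:R ^- 2 * \sum_(i < d) gap i *
      \sum_(j < n) \sum_(k < n) (1 - q i) ^+ (j - k + (k - j)).
  transitivity (\int[P]_w (n%:R ^- 2 * \sum_(j < n) \sum_(k < n) (Y j w * Y k w))).
    apply: eq_Rintegral => w _; rewrite expr_div_n mulrC; congr (_ * _).
    rewrite expr2 mulr_suml; apply: eq_bigr => j _.
    by rewrite mulr_sumr.
  have iS (j : 'I_n) : P.-integrable setT
      (fun w => (\sum_(k < n) Y j w * Y k w)%:E).
    exact: integrable_sum_EFin.
  rewrite RintegralZl//; last first.
    exact: integrable_sum_EFin.
  rewrite Rintegral_sum//.
  under eq_bigr do rewrite Rintegral_sum//.
  under eq_bigr do (under eq_bigr do rewrite chain_correlation//).
  under eq_bigr do rewrite big_split/= sumr_const card_ord.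
  rewrite big_split/= sumr_const card_ord mulrDr; congr (_ + _).
    rewrite -mulrnA -[_ *+ (n * n)]mulr_natl natrM -expr2.
    by rewrite mulKf// expf_neq0.
  congr (_ * _); under eq_bigr do rewrite exchange_big/=.
  rewrite exchange_big; apply: eq_bigr => i _.
  by rewrite mulr_sumr; apply: eq_bigr => j _; rewrite mulr_sumr.
rewrite varianceE// (expectationE (Lfun2_integrable L2)) EX.
rewrite expectationE; last exact: Lfun2_integrable_sqr.
rewrite EX2 -EFin_expe -EFinB lee_fin [X in X - _]addrC addrK.
rewrite !mulr_sumr; apply: ler_sum => i _.
set S := \sum_(j < n) _.
have S0 : 0 <= S.
  do 2 (apply: sumr_ge0 => ? _); rewrite exprn_ge0// subr_ge0.
  by have /andP[] := q01 i.
have Sn : S <= n%:R * (2 / q i) by exact: sum_geometric_dist_le.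
have -> : 2 / n%:R * (c i / q i) = n%:R ^- 2 * (c i * (n%:R * (2 / q i))).
  by have /andP[q0 _] := q01 i; field; rewrite nR gt_eqF.
rewrite ler_wpM2l ?invr_ge0 ?exprn_ge0 ?ler0n//.
by rewrite (le_trans (ler_wpM2r S0 (gapc i)))// ler_wpM2l.
Qed.

End ChainCorrelations.

(** * Running time *)

Definition init_cost {R : realType} (d : nat) (Kg Knormals KAU : R) : R :=
  d%:R + 1 + `|Knormals| * d%:R + `|KAU| * d%:R ^+ 2 + `|Kg| * d%:R.

Definition step_cost {R : realType} (d : nat) (Kg KN : R) : R :=
  (`|KN| + `|Kg|) * d%:R + 1.

Definition normal_cost {R : realType} (d : nat) (Knormals Kupdate : R) : R :=
  `|Knormals| + `|Kupdate| * d%:R.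

Section RunningTime.
Context {R : realType} {d : nat} {ct : cost_model R d}.
Context {Kg Knormals KN KAU Kupdate : R}.
Hypothesis cc : cost_conventions ct Kg Knormals KN KAU Kupdate.
Hypothesis hd : (0 < d)%N.
Variables (g : 'cV[R]_d -> R) (A : 'M[R]_d).
Local Notation D := (d%:R : R).
Local Notation init_cost := (init_cost d Kg Knormals KAU).
Local Notation step_cost := (step_cost d Kg KN).
Local Notation normal_cost := (normal_cost d Knormals Kupdate).

(** Absolute values are taken because the implied constants carry no sign condition. *)
Lemma GRDR_loop_time_le u (N : nat -> nat) (G : nat -> 'cV[R]_d) (k : nat) :
  (forall l, (l < k)%N -> (0 < N l <= d)%N) ->
  (st_time (GRDR_loop ct g A N G k (GRDR_init ct g A u)))%:R <=
  init_cost + \sum_(l < k) (step_cost + normal_cost * (N l)%:R).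
Proof.
have norm_le (K x : R) : 0 <= x -> K * x <= `|K| * x.
  by move=> x0; rewrite ler_wpM2r// ler_norm.
have tg z : (time_g ct z)%:R <= `|Kg| * D.
  by rewrite (le_trans (time_g_le cc z))// norm_le.
elim: k => [_|k IH Nk].
  rewrite big_ord0 addr0 /= !natrD -[d.+1%:R]natr1 /init_cost.
  apply: lerD => //; apply: lerD.
    apply: lerD => //.
    by rewrite (le_trans (time_normals_le cc hd))// norm_le.
  by rewrite (le_trans (time_AU_le cc))// norm_le// exprn_ge0.
rewrite big_ord_recr/= addrA natrD lerD//.
  by apply: IH => l lk; apply: Nk; exact: ltnW.
have Nd := Nk k (ltnSn k); have /andP[N0 _] := Nd.
rewrite !natrD /step_cost /normal_cost.
have h1 : (time_N ct (N k))%:R <= `|KN| * D.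
  by rewrite (le_trans (time_N_le cc Nd))// norm_le.
have h2 : (time_normals ct (N k))%:R <= `|Knormals| * (N k)%:R.
  by rewrite (le_trans (time_normals_le cc N0))// norm_le.
have h3 : (time_update ct (N k))%:R <= `|Kupdate| * (D * (N k)%:R).
  by rewrite (le_trans (time_update_le cc Nd))// norm_le// mulr_ge0.
set z := _ + A *m _; have h4 := tg z; lra.
Qed.

(** Here [m] stands for the number of iterations and [s] for the expected number of
    coordinates renewed by one of them. The coefficient collects the constants of the
    costs, [4] coming from the operations outside the subroutines. *)
Lemma expected_cost_le (m : R) (s : R) : 0 <= m <= D -> 0 <= s -> m * s <= D ->
  init_cost + 1 + (m * step_cost + normal_cost * (m * s)) <=
  (4 + 2 * `|Knormals| + `|KAU| + 2 * `|Kg| + `|KN| + `|Kupdate|) * D ^+ 2.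
Proof.
move=> /andP[m0 mD] s0 msD.
have D1 : 1 <= D by rewrite ler1n.
have D0 : 0 <= D by exact: le_trans D1.
have DD : D <= D ^+ 2 by rewrite expr2 ler_peMl.
have mstep : m * step_cost <= D * step_cost.
  by rewrite ler_wpM2r// addr_ge0// mulr_ge0// addr_ge0.
have mnormal : normal_cost * (m * s) <= normal_cost * D.
  by rewrite ler_wpM2l// addr_ge0// mulr_ge0.
have KD (K : R) : 0 <= K -> K * D <= K * D ^+ 2 by move=> K0; rewrite ler_wpM2l.
have h1 := KD _ (normr_ge0 Knormals).
have h2 := KD _ (normr_ge0 Kg).
rewrite /init_cost; rewrite /step_cost in mstep; rewrite /normal_cost in mnormal.
have -> : D ^+ 2 = D * D by rewrite expr2.
rewrite expr2 in DD h1 h2.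
rewrite /step_cost /normal_cost.
move: (normr_ge0 Knormals) (normr_ge0 KAU) (normr_ge0 Kg) (normr_ge0 KN).
lra.
Qed.

End RunningTime.

(** The integral of a nonnegative function is a supremum over the simple functions
    below it, hence monotone without any measurability. *)
Lemma le_expectation {R : realType} {disp} {Omega : measurableType disp}
    (P : probability Omega R) (X Y : Omega -> R) :
  (forall w, 0 <= X w) -> (forall w, X w <= Y w) -> ('E_P[X] <= 'E_P[Y])%E.
Proof.
move=> X0 XY; rewrite unlock !ge0_integralTE; last 2 first.
- by move=> w; rewrite lee_fin (le_trans (X0 w)).
- by move=> w; rewrite lee_fin.
apply: ereal_sup_le => _ [h hX <-]; exists h => // w.
by rewrite (le_trans (hX w))// lee_fin.
Qed.

Section NumberOfIterations.
Context {R : realType} {d : nat} {q : 'I_d -> R}.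
Hypothesis hd : (0 < d)%N.
Hypothesis q0 : forall i, 0 < q i.
Local Notation s := (\sum_(i < d) q i).

Let s_gt0 : 0 < s.
Proof.
rewrite (bigD1 (Ordinal hd))//= ltr_pwDl//.
by apply: sumr_ge0 => i _; exact: ltW.
Qed.

Let ceil_ratio_gt0 : 0 < Num.ceil (d%:R / s).
Proof. by rewrite ceil_gt0 divr_gt0// ltr0n. Qed.

Let GRDR_nE : (GRDR_n q)%:R = (Num.ceil (d%:R / s))%:~R :> R.
Proof. by rewrite /GRDR_n pmulrn gez0_abs// ltW. Qed.

Lemma GRDR_n_gt0 : (0 < GRDR_n q)%N.
Proof. by rewrite absz_gt0 gt_eqF. Qed.

Lemma GRDR_n_ge : d%:R <= (GRDR_n q)%:R * s.
Proof. by rewrite -ler_pdivrMr// GRDR_nE ceil_ge. Qed.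

(** The expected number of coordinates renewed in the whole loop is at most [d]. *)
Lemma GRDR_n_pred_le : (GRDR_n q).-1%:R * s <= d%:R.
Proof.
rewrite -ler_pdivlMr//; have := ceilB1_lt (d%:R / s).
rewrite intrB -GRDR_nE -(natrB _ GRDR_n_gt0) subn1; exact: ltW.
Qed.

End NumberOfIterations.

Section ExpectedDraws.
Context {R : realType} {d : nat} {q : 'I_d -> R}.
Context {disp : measure_display} {Omega : measurableType disp}.
Context {P : probability Omega R}.
Context {U : 'I_d -> {RV P >-> R}} {N : nat -> {RV P >-> nat}}.
Context {G : nat -> 'I_d -> {RV P >-> R}}.
Hypothesis draws : GRDR_randomness q U N G.

Lemma expected_N (k : 'I_(GRDR_n q).-1) :
  P.-integrable setT (fun w => (N k w)%:R%:E) /\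
  \int[P]_w (N k w)%:R = \sum_(i < d) q i.
Proof.
case: draws => _ dN dq _ _.
have mN : measurable_fun [set: Omega] (N k) by apply: measurable_funP.
have NE w : (N k w)%:R = \sum_(i < d) (\1_[set w | (i < N k w)%N] w : R).
  have /andP[_ Nd] := dN k w.
  rewrite (eq_bigr (fun i : 'I_d => (i < N k w)%N%:R)) => [|i _]; last first.
    by rewrite indicE mem_setE.
  rewrite -natr_sum -(big_mkord xpredT (fun i => nat_of_bool (i < N k w)%N)).
  rewrite (big_cat_nat (n := N k w))//= big_nat (eq_bigr (fun=> 1%N)) => [|i].
    rewrite -big_nat sum_nat_const_nat subn0 muln1.
    rewrite big_nat big1 ?addn0// => i /andP[Ni _].
    by rewrite ltnNge Ni.
  by move=> /andP[_ ->].
have mlt (i : 'I_d) : measurable [set w | (i < N k w)%N].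
  by rewrite -[X in measurable X]setTI; exact: (mN _ [set n | (i < n)%N]).
have i1 (i : 'I_d) : P.-integrable setT
    (fun w => (\1_[set w | (i < N k w)%N] w)%:E : \bar R).
  apply: (le_integrable _ _ _ (finite_measure_integrable_cst P 1 measurableT)) => //.
  - by apply/measurable_EFinP; exact: measurable_indic.
  - move=> w _; rewrite /= lee_fin normr1 indicE.
    by case: (_ \in _); rewrite ?normr1 ?normr0.
split; first by under eq_fun do rewrite NE; exact: integrable_sum_EFin.
under eq_Rintegral do rewrite NE.
rewrite Rintegral_sum//; apply: eq_bigr => i _.
by rewrite /Rintegral integral_indic// setIT; exact: (congr1 fine (dq k i)).
Qed.

End ExpectedDraws.

(** * The variance and running time bounds *)

Theorem theorem4p2 (R : realType) (Kg Knormals KN KAU Kupdate : R) :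
  exists c : R,
  forall (d : nat) (hd : (0 < d)%N) (M Q : 'M[R]_d) (lambda : 'rV[R]_d)
    (kappa : R) (g : 'cV[R]_d -> R) (ct : cost_model R d),
  posdef M ->
  char_poly M = \prod_(i < d) ('X - (lambda 0 i)%:P) ->
  (forall i j : 'I_d, (i <= j)%N -> lambda 0 j <= lambda 0 i) ->
  Q *m Q^T = 1%:M ->
  M = Q *m diag_mx lambda *m Q^T ->
  0 < kappa ->
  measurable_fun [set: borel_vec d] (g : borel_vec d -> R) ->
  gaussian_lipschitz kappa M g ->
  gaussian_square_integrable M g ->
  cost_conventions ct Kg Knormals KN KAU Kupdate ->
  let A := Q *m diag_mx (map_mx Num.sqrt lambda) in
  let q := fun i : 'I_d => Num.sqrt (lambda 0 i / lambda 0 (Ordinal hd)) in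
  forall (disp : measure_display) (Omega : measurableType disp)
    (P : probability Omega R) (U : 'I_d -> {RV P >-> R})
    (N : nat -> {RV P >-> nat}) (G : nat -> 'I_d -> {RV P >-> R}),
  GRDR_randomness q U N G ->
  ('E_P[GRDR_random_time ct g A q U N G] <= (2 * c * d%:R ^+ 2)%R%:E)%E /\
  ('V_P[GRDR_random_output ct g A q U N G] <=
     (2 * kappa ^+ 2 / d%:R * (\sum_(i < d) Num.sqrt (lambda 0 i)) ^+ 2)%R%:E)%E.
Proof.
exists (4 + 2 * `|Knormals| + `|KAU| + 2 * `|Kg| + `|KN| + `|Kupdate|).
move=> d hd M Q lambda kappa g ct [_ pM] _ lambda_dec QQ ME _ mg lip sqint cc A q.
move=> disp Omega P U N G draws.
have QtQ : Q^T *m Q = 1%:M by exact: mulmx1C.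
have lambda0 i : 0 < lambda 0 i.
  (* The column [i] of [Q] is an eigenvector of [M] for [lambda 0 i]. *)
  pose e : 'cV[R]_d := delta_mx i 0.
  have := pM (Q *m e).
  have -> : ((Q *m e)^T *m M *m (Q *m e)) 0 0 = lambda 0 i.
    rewrite ME trmx_mul !mulmxA -[_ *m Q^T *m Q]mulmxA QtQ mulmx1.
    rewrite -(mulmxA _ Q^T Q) QtQ mulmx1 trmx_delta -rowE -colE !mxE.
    by rewrite eqxx mulr1n.
  apply; apply: contraTneq (oner_neq0 R) => Qi0; rewrite negbK.
  have := congr1 (mulmx Q^T) Qi0; rewrite mulmxA QtQ mul1mx mulmx0.
  by move=> /colP/(_ i); rewrite !mxE !eqxx => /eqP.
have AE : A *m A^T = M.
  rewrite /A ME trmx_mul tr_diag_mx !mulmxA -(mulmxA Q) mulmx_diag.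
  congr (Q *m diag_mx _ *m _); apply/rowP => i; rewrite !mxE.
  by rewrite -expr2 sqr_sqrtr// ltW.
have AtA : A^T *m A = diag_mx lambda.
  rewrite /A trmx_mul tr_diag_mx !mulmxA -(mulmxA _ Q^T) QtQ mulmx1 mulmx_diag.
  congr diag_mx; apply/rowP => i; rewrite !mxE.
  by rewrite -expr2 sqr_sqrtr// ltW.
have q0 i : 0 < q i by rewrite sqrtr_gt0 divr_gt0.
have q1 i : q i <= 1.
  rewrite -sqrtr1 ler_wsqrtr// ler_pdivrMr// mul1r.
  exact: lambda_dec.
have n0 : (0 < GRDR_n q)%N by exact: GRDR_n_gt0.
have s1 : 1 <= \sum_(i < d) q i.
  rewrite (bigD1 (Ordinal hd))//= {1}/q divff ?gt_eqF// sqrtr1 lerDl.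
  by apply: sumr_ge0 => i _; exact: ltW.
have n_le := GRDR_n_pred_le hd q0.
have n_ge := GRDR_n_ge hd q0.
have case_N := draws_N_range draws.
split.
  set K := (X in 2 * X).
  apply: (@le_trans _ _ (K * d%:R ^+ 2)%:E); last first.
    rewrite lee_fin ler_wpM2r ?exprn_ge0// ler_peMl ?ler1n//.
    by rewrite !addr_ge0// mulr_ge0.
  set m := (GRDR_n q).-1 in case_N n_le *.
  have m0 : (m%:R : R) <= d%:R.
    by apply: le_trans n_le; rewrite ler_peMr.
  pose s := \sum_(i < d) q i.
  have s0 : 0 <= s by exact: le_trans s1.
  pose a := init_cost d Kg Knormals KAU + 1 + m%:R * step_cost d Kg KN.
  pose b := normal_cost d Knormals Kupdate.
  have iN (l : 'I_m) : P.-integrable setT (fun w => (N l w)%:R%:E).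
    by case: (expected_N draws l).
  have isum := integrable_sum_EFin (index_enum 'I_m) measurableT iN.
  have ibsum : P.-integrable setT (fun w => (b * \sum_(l < m) (N l w)%:R)%:E).
    by under eq_fun do rewrite EFinM; exact: integrableZl.
  have ia : P.-integrable setT (fun=> a%:E).
    exact: finite_measure_integrable_cst.
  have iT : P.-integrable setT (fun w => (a + b * \sum_(l < m) (N l w)%:R)%:E).
    by under eq_fun do rewrite EFinD; exact: integrableD.
  apply: (@le_trans _ _ 'E_P[fun w => (a + b * \sum_(l < m) (N l w)%:R)%R]%E).
    apply: le_expectation => w; first exact: ler0n.
    rewrite /GRDR_random_time /GRDR_time natrD /GRDR_final -/m.
    have := GRDR_loop_time_le cc hd g A (\col_i U i w) (N := fun k => N k w)
      (fun k => \col_i G k i w) (k := m) (fun l lm => case_N (Ordinal lm) w).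
    rewrite big_split/= sumr_const card_ord -mulr_sumr -mulr_natl -/b => h.
    rewrite /a; lra.
  have int_a : \int[P]_w a = a.
    transitivity (a * fine (P setT)); first exact: Rintegral_cst.
    by rewrite probability_setT mulr1.
  rewrite expectationE// lee_fin RintegralD// int_a RintegralZl// Rintegral_sum//.
  rewrite (eq_bigr (fun=> s)) => [|l _]; last by case: (expected_N draws l).
  rewrite sumr_const card_ord -[s *+ _]mulr_natl.
  have := expected_cost_le (Kg := Kg) (Knormals := Knormals) (KN := KN)
    (KAU := KAU) (Kupdate := Kupdate) hd (m := m%:R) (s := s).
  rewrite ler0n m0 => /(_ isT s0 n_le).
  by rewrite /a /b -/K addrA.
pose f x := g (A *m x).
have mf : measurable_fun [set: borel_vec d] (f : borel_vec d -> R).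
  apply: (measurableT_comp mg).
  exact: (@measurable_mulmx R d d A _ (borel_vec d) (fun x => x)).
have nU := normal_family_init draws.
have nV := normal_family_two_copies nU.
have fL2 :
    (fun w => f (selection (two_copies (U := fun i => U i : Omega -> R)) xpred0 w))
    \in Lfun (P \x P)%E 2%:E.
  apply: Lfun2P; first exact: (measurable_fun_selection mf nV).
  have law := selection_has_law_N0 nV A xpred0; rewrite AE in law.
  by have := sqint _ _ _ _ law; rewrite unlock.
have gap_lambda (i : 'I_d) :
    gap (P := P) (U := fun i => U i : Omega -> R) f i <= kappa ^+ 2 * lambda 0 i.
  have -> : kappa ^+ 2 * lambda 0 i = kappa ^+ 2 * (2 * lambda 0 i) / 2 by field.
  apply: (gap_le nU mf fL2) => a b ab.
  apply: (gaussian_lipschitz_selection nV _ AtA ab).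
  by rewrite AE.
have c0 (i : 'I_d) : 0 <= kappa ^+ 2 * lambda 0 i.
  by rewrite mulr_ge0 ?sqr_ge0 ?ltW.
have q01 i : 0 < q i <= 1 by rewrite q0 q1.
have outE : GRDR_random_output ct g A q U N G =
    (fun w => (\sum_(k < (GRDR_n q).-1.+1)
      f (random_chain (U := U) (N := N) (G := G) k w)) /
      (GRDR_n q)%:R).
  by apply/funext => w; rewrite /GRDR_random_output /GRDR_output GRDR_loop_S.
rewrite outE.
apply: le_trans (variance_chain_average draws mf fL2 n0 q01 c0 gap_lambda) _.
rewrite lee_fin; set n : R := (GRDR_n q)%:R in n_ge *.
pose L0 := Num.sqrt (lambda 0 (Ordinal hd)).
pose S := \sum_(i < d) Num.sqrt (lambda 0 i).
have L0_gt0 : 0 < L0 by rewrite sqrtr_gt0.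
have qE i : q i = Num.sqrt (lambda 0 i) / L0.
  by rewrite /q sqrtrM ?ltW// sqrtrV// ltW.
have sE : \sum_(i < d) q i = S / L0.
  by rewrite /S mulr_suml; apply: eq_bigr => i _; exact: qE.
have ratioE i : kappa ^+ 2 * lambda 0 i / q i =
    kappa ^+ 2 * L0 * Num.sqrt (lambda 0 i).
  have sq0 : 0 < Num.sqrt (lambda 0 i) by rewrite sqrtr_gt0.
  rewrite qE -{1}(sqr_sqrtr (ltW (lambda0 i))); field.
  by rewrite !gt_eqF.
under eq_bigr do rewrite ratioE.
rewrite -mulr_sumr -/S; rewrite sE in n_ge.
have n_gt0 : 0 < n by rewrite ltr0n.
have d_gt0 : 0 < d%:R :> R by rewrite ltr0n.
have S0 : 0 <= S by apply: sumr_ge0 => i _; exact: sqrtr_ge0.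
have nS : d%:R * L0 <= n * S.
  by rewrite -ler_pdivlMr// -mulrA.
have -> : 2 / n * (kappa ^+ 2 * L0 * S) =
    (2 * kappa ^+ 2 * S / (n * d%:R)) * (d%:R * L0).
  by field; rewrite !gt_eqF.
have -> : 2 * kappa ^+ 2 / d%:R * S ^+ 2 =
    (2 * kappa ^+ 2 * S / (n * d%:R)) * (n * S).
  by field; rewrite !gt_eqF.
apply: ler_wpM2l nS; apply: divr_ge0; last by rewrite mulr_ge0 ?ler0n.
by apply: mulr_ge0 S0; rewrite mulr_ge0// sqr_ge0.
Qed.
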